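(* Let $(\mathcal{A},m)$ be a nonempty multiarrangement in an $\ell$-dimensional vector space $V$ over a field $\mathbb{K}$ with $\ell\ge 2$, let $H_0\in\mathcal{A}$ with defining form $\alpha_0$, and let $(\mathcal{A},m),(\mathcal{A}',m'),(\mathcal{A}'',m^* )$ be the triple with respect to $H_0$. Assume that $(\mathcal{A},m)$ and $(\mathcal{A}',m')$ are both free. Take a basis $\{\theta_1,\ldots,\theta_\ell\}$ for $D(\mathcal{A}',m')$ and $k\in\{1,\ldots,\ell\}$ such that $\{\theta_1,\ldots,\theta_{k-1},\alpha_0\theta_k,\theta_{k+1},\ldots,\theta_\ell\}$ is a basis for $D(\mathcal{A},m)$ (such a basis exists). Then $\{\overline{\theta_1},\ldots,\overline{\theta_{k-1}},\overline{\theta_{k+1}},\ldots,\overline{\theta_\ell}\}$ is a basis for $D(\mathcal{A}'',m^* )$.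
   Context: Let $\mathbb{K}$ be a field, $V$ an $\ell$-dimensional $\mathbb{K}$-vector space, $S=\mathrm{Sym}(V^* )\cong\mathbb{K}[x_1,\ldots,x_\ell]$, and $\mathrm{Der}_{\mathbb{K}}(S)=\bigoplus_i S\,\partial_{x_i}$ the $S$-module of $\mathbb{K}$-linear derivations of $S$. An arrangement is a finite set $\mathcal{A}$ of hyperplanes of $V$, all containing the origin; for each $H\in\mathcal{A}$ fix a linear form $\alpha_H$ with $H=\ker\alpha_H$. A multiarrangement $(\mathcal{A},m)$ is an arrangement with a multiplicity $m:\mathcal{A}\to\mathbb{Z}_{>0}$. Define $D(\mathcal{A},m)=\{\theta\in\mathrm{Der}_{\mathbb{K}}(S)\mid\theta(\alpha_H)\in\alpha_H^{m(H)}S\text{ for all }H\in\mathcal{A}\}$; $(\mathcal{A},m)$ is free if $D(\mathcal{A},m)$ is a free $S$-module. A nonzero derivation $\theta=\sum f_i\partial_{x_i}$ is homogeneous of degree $p$ if each $f_i$ is zero or homogeneous of degree $p$. Triple with respect to $H_0\in\mathcal{A}$, with $\alpha_0=\alpha_{H_0}$: Deletion $(\mathcal{A}',m')$: if $m(H_0)=1$, then $\mathcal{A}'=\mathcal{A}\setminus\{H_0\}$ and $m'=m|_{\mathcal{A}'}$; if $m(H_0)\ge2$, then $\mathcal{A}'=\mathcal{A}$, $m'(H)=m(H)$ for $H\ne H_0$, and $m'(H_0)=m(H_0)-1$. Restriction $(\mathcal{A}'',m^* )$: $\mathcal{A}''=\{H_0\cap K\mid K\in\mathcal{A}\setminus\{H_0\}\}$,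 an arrangement in the vector space $H_0$, and $m^*$ is the Euler multiplicity: for $X\in\mathcal{A}''$ put $\mathcal{A}_X=\{H\in\mathcal{A}\mid X\subset H\}$, $m_X=m|_{\mathcal{A}_X}$, and choose coordinates so that $X=\{x_1=x_2=0\}$; then $D(\mathcal{A}_X,m_X)$ has a homogeneous basis $\theta_X,\psi_X,\partial_{x_3},\ldots,\partial_{x_\ell}$ with $\theta_X\notin\alpha_0\mathrm{Der}_{\mathbb{K}}(S)$ and $\psi_X\in\alpha_0\mathrm{Der}_{\mathbb{K}}(S)$, and $m^*(X):=\deg\theta_X$. Let $\overline{S}=S/\alpha_0S$ (the coordinate ring of $H_0$) and let $\overline{f}$ be the image of $f\in S$ in $\overline{S}$. For $\theta\in D(\mathcal{A},m)$, $\overline{\theta}$ is the derivation of $\overline{S}$ given by $\overline{\theta}(\overline{f})=\overline{\theta(f)}$. $D(\mathcal{A}'',m^* )$ is a module over $\overline{S}$. *)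

(* Defs.v *)
From HB Require Import structures.
From mathcomp Require Import all_boot all_order all_algebra.
From mathcomp Require Import generic_quotient ring_quotient.
From mathcomp Require Export finmap mpoly.
From mathcomp.classical Require boolp.

Set Implicit Arguments.
Unset Strict Implicit.
Unset Printing Implicit Defensive.

Import GRing.Theory.

Local Open Scope fset_scope.
Local Open Scope ring_scope.
Local Open Scope quotient_scope.

(* Derivations of a commutative K-algebra R, whose K-algebra structure is given
   by its structure map iota : K -> R. Submodules of Der_K(R) are represented as
   predicates on functions R -> R, with pointwise R-module operations. *)
Section Derivations.

Variables (K : fieldType) (R : comNzRingType) (iota : K -> R).

Definition derivation (d : R -> R) : Prop :=
  [/\ forall f g, d (f + g) = d f + d g,
      forall c f, d (iota c * f) = iota c * d f
    & forall f g, d (f * g) = d f * g + f * d g].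

Definition scale_der (a : R) (d : R -> R) : R -> R := fun f => a * d f.

(* d belongs to the submodule a Der_K(R) *)
Definition in_mulDer (a : R) (d : R -> R) : Prop :=
  exists2 d', derivation d' & d =1 scale_der a d'.

Definition is_basis (D : (R -> R) -> Prop) (I : finType) (th : I -> R -> R) :
    Prop :=
  [/\ forall i, D (th i),
      forall d, D d -> exists c : I -> R, forall f, d f = \sum_i c i * th i f
    & forall c : I -> R, (forall f, \sum_i c i * th i f = 0) ->
        forall i, c i = 0].

(* Only finite bases are considered: the modules D(A, m) are submodules of a
   finitely generated module over a Noetherian ring. *)
Definition free_module (D : (R -> R) -> Prop) : Prop :=
  exists (n : nat) (th : 'I_n -> R -> R), is_basis D th.

(* The module D(A, m): the arrangement A is a finite set of labels, form H is
   the element of R which is the defining form of H. *)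
Definition Dmod (T : choiceType) (A : {fset T}) (form : T -> R) (m : T -> nat)
    (d : R -> R) : Prop :=
  derivation d /\
  forall H, H \in A -> exists g, d (form H) = form H ^+ m H * g.

End Derivations.

(* V is a vector space with a basis b of size l, and S = Sym(V^* ) is {mpoly K[l]}
   where 'X_i is the i-th coordinate of V in the basis b. *)
Section Coordinates.

Variables (K : fieldType) (V : vectType K) (l : nat) (b : l.-tuple V).

(* The linear form f of V as an element of S. *)
Definition lform (f : 'Hom(V, K^o)) : {mpoly K[l]} :=
  \sum_(i < l) (f b`_i : K) *: 'X_i.

(* The directional derivative along v; if y_i are the coordinates in a basis e of
   V, then partial e`_i is d/dy_i, see partial_lform. *)
Definition partial (v : V) (p : {mpoly K[l]}) : {mpoly K[l]} :=
  \sum_(i < l) coord b i v *: p^`M(i).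

Lemma partial_lform v f : basis_of fullv b -> partial v (lform f) = (f v)%:MP.
Proof.
move=> /coord_basis/(_ (memvf v)) {2}->; rewrite linear_sum raddf_sum /=.
apply: eq_bigr => i _; rewrite linearZ /= rmorphM /= mul_mpolyC; congr (_ *: _).
rewrite /lform linear_sum /= (bigD1 i) //= big1 => [|j ji].
  rewrite mderivZ mderivX mnm1E eqxx scale1r addr0.
  have -> : (U_(i) - U_(i) = 0)%MM by apply/mnmP => j; rewrite !mnmE subnn.
  by rewrite mpolyX0 -mul_mpolyC mulr1.
by rewrite mderivZ mderivX mnm1E (negbTE ji) scale0r scaler0.
Qed.

Definition homog_der (d : nat) (th : {mpoly K[l]} -> {mpoly K[l]}) : Prop :=
  (exists f, th f != 0) /\ forall i : 'I_l, th 'X_i \is d.-homog.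

Definition DS := Dmod (mpolyC l (R := K)).

Definition lideal (f : 'Hom(V, K^o)) : {pred {mpoly K[l]}} :=
  fun p => boolp.asbool (exists g, p = lform f * g).

Lemma lform_meval0 (f : 'Hom(V, K^o)) : (lform f).@[fun=> 0] = 0.
Proof.
rewrite /lform raddf_sum /= big1 // => i _.
by rewrite mevalZ mevalXU mulr0.
Qed.

Lemma lideal_closed f : idealr_closed (lideal f).
Proof.
split.
- by apply/boolp.asboolP; exists 0; rewrite mulr0.
- apply/negP => /boolp.asboolP [g] /(congr1 (meval (fun=> 0))) /eqP.
  by rewrite mevalM lform_meval0 mul0r meval1 oner_eq0.
- move=> a u v /boolp.asboolP [g ->] /boolp.asboolP [h ->].
  by apply/boolp.asboolP; exists (a * g + h); rewrite mulrDr mulrCA.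
Qed.

HB.instance Definition _ f :=
  isIdealr.Build {mpoly K[l]} (lideal f) (lideal_closed f).

(* S / fS *)
Definition Sbar (f : 'Hom(V, K^o)) : comNzRingType := {ideal_quot (lideal f)}.

Definition pibar (f : 'Hom(V, K^o)) (p : {mpoly K[l]}) : Sbar f :=
  \pi_{ideal_quot (lideal f)} p.

(* The map induced by th on S / fS; see derbarE. *)
Definition derbar (f : 'Hom(V, K^o)) (th : {mpoly K[l]} -> {mpoly K[l]})
    (u : Sbar f) : Sbar f :=
  pibar f (th (repr (u : {ideal_quot (lideal f)}))).

Lemma derbarE f th : derivation (mpolyC l (R := K)) th ->
  (exists g, th (lform f) = lform f * g) ->
  forall p, derbar th (pibar f p) = pibar f (th p).
Proof.
move=> [thD _ thM] [g thf] p; rewrite /derbar /pibar.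
have th0 : th 0 = 0 by apply: (addrI (th 0)); rewrite -thD !addr0.
have thN q : th (- q) = - th q.
  by apply/eqP; rewrite -addr_eq0 -thD addNr th0.
set q := repr _; apply/eqP; rewrite -Quotient.idealrBE -thN -thD.
have : q - p \in lideal f by rewrite Quotient.idealrBE reprK.
case/boolp.asboolP => h ->; apply/boolp.asboolP.
by exists (g * h + th h); rewrite thM thf -mulrA -mulrDr.
Qed.

Definition DSbar (f : 'Hom(V, K^o)) := Dmod (fun c : K => pibar f c%:MP).

End Coordinates.

Section Arrangements.

Variables (K : fieldType) (V : vectType K).

Definition multiarrangement (A : {fset {vspace V}}) (m : {vspace V} -> nat) :
    Prop :=
  forall H, H \in A -> (\dim H).+1 = \dim {:V} /\ (0 < m H)%N.

(* Multiplicities are functions on all subspaces of V; their values outside of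
   the arrangement are irrelevant. *)
Definition del_arr (A : {fset {vspace V}}) (m : {vspace V} -> nat)
    (H0 : {vspace V}) : {fset {vspace V}} :=
  if m H0 == 1%N then A `\ H0 else A.

Definition del_mult (m : {vspace V} -> nat) (H0 H : {vspace V}) : nat :=
  if H == H0 then (m H0).-1 else m H.

Definition res_arr (A : {fset {vspace V}}) (H0 : {vspace V}) :
    {fset {vspace V}} :=
  [fset (H0 :&: H)%VS | H in A `\ H0].

Definition loc_arr (A : {fset {vspace V}}) (X : {vspace V}) :
    {fset {vspace V}} :=
  [fset H in A | (X <= H)%VS].

(* d is the Euler multiplicity m^*(X): in some coordinates y_i, given by a basis
   e of V, with X = {y_0 = y_1 = 0} (indices start at 0). *)
Definition is_euler_mult (l : nat) (b : l.-tuple V) (A : {fset {vspace V}})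
    (m : {vspace V} -> nat) (alpha : {vspace V} -> 'Hom(V, K^o))
    (H0 X : {vspace V}) (d : nat) : Prop :=
  exists (e : l.-tuple V) (th ps : {mpoly K[l]} -> {mpoly K[l]}),
    [/\ basis_of fullv e,
        forall v, v \in X <-> forall i : 'I_l, (i < 2)%N -> coord e i v = 0,
        is_basis (DS (loc_arr A X) (fun H => lform b (alpha H)) m)
          (fun i : 'I_l => if val i == 0%N then th
                           else if val i == 1%N then ps
                           else partial b e`_i),
        homog_der d th /\ (exists d', homog_der d' ps)
      & ~ in_mulDer (mpolyC l (R := K)) (lform b (alpha H0)) th /\
        in_mulDer (mpolyC l (R := K)) (lform b (alpha H0)) ps].

End Arrangements.

(* Main.v *)
(* Existence. Take a homogeneous basis theta of D' and a basis phi of D, and write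
   alpha_0 theta_k = sum_i R_ki phi_i. If all R_ki vanished at the origin, det R
   would have order at least l there; as det R divides alpha_0 ^ l, the inclusion
   of D in D' would then be an equality, which it is not. So some R_ki is nonzero
   at the origin. With v_j = theta_j(alpha_0) / alpha_0 ^ (m(H_0) - 1), the
   derivation v_j theta_k - v_k theta_j is in D, and expanding it in phi shows,
   after taking a homogeneous component, that v_j is a multiple of v_k modulo
   alpha_0. Subtracting multiples of theta_k makes the basis adapted.

   Restriction. Linear independence holds because a combination of the theta_j,
   j <> k, that is divisible by alpha_0 is alpha_0 times an element of D'. Let N be
   the span of the restricted derivations, that is, the image of D. For delta in
   D(A'', m^* ) and X in A'', the product of alpha_H ^ m(H) over the H not
   containing X maps delta into N, because locally at X one can lift delta using
   theta_X; likewise for the product over all H <> H_0. Since N is free and the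
   restricted forms are prime, the latter factors can be cancelled one at a time,
   so delta is in N. *)

From HB Require Import structures.
Require Import Defs.
From mathcomp Require Import all_boot all_order all_algebra.
From mathcomp Require Import perm generic_quotient ring_quotient.
From mathcomp.classical Require boolp.

Set Implicit Arguments.
Unset Strict Implicit.
Unset Printing Implicit Defensive.

Import GRing.Theory.

Local Open Scope fset_scope.
Local Open Scope quotient_scope.
Local Open Scope ring_scope.

(** * Order at the origin and homogeneous factors of polynomials *)

Section Polynomials.

Variables (n : nat) (K : fieldType).
Implicit Types (p q r : {mpoly K[n]}).

(** Membership in the [d]-th power of the maximal ideal of the origin. *)
Definition order_ge (d : nat) p := forall m, (mdeg m < d)%N -> p@_m = 0.

Lemma order_ge0 p : order_ge 0 p. Proof. by []. Qed.

Lemma order_ge_sum (d : nat) (I : finType) (F : I -> {mpoly K[n]}) :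
  (forall i, order_ge d (F i)) -> order_ge d (\sum_i F i).
Proof. by move=> hF m md; rewrite raddf_sum /= big1 // => i _; exact: hF. Qed.

Lemma order_geM d e p q :
  order_ge d p -> order_ge e q -> order_ge (d + e) (p * q).
Proof.
move=> hp hq m md; rewrite mcoeffM big1 // => -[k1 k2] /= /eqP mE.
have [lt1|ge1] := ltnP (mdeg k1) d; first by rewrite hp // mul0r.
move: (congr1 mdeg mE); rewrite mdegD => mdE; rewrite hq ?mulr0 //.
by rewrite -(ltn_add2l d); apply: leq_ltn_trans md;
  rewrite [leqRHS]mdE leq_add2r.
Qed.

Lemma order_ge_prod (I : finType) (F : I -> {mpoly K[n]}) :
  (forall i, order_ge 1 (F i)) -> order_ge #|I| (\prod_i F i).
Proof.
move=> hF; rewrite -sum1_card.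
apply: (big_ind2 (fun d p => order_ge d p)) => // d1 p1 d2 p2.
exact: order_geM.
Qed.

Lemma order_ge_leq d e p :
  p \is d.-homog -> p != 0 -> order_ge e p -> (e <= d)%N.
Proof.
move=> /dhomogP hp p0 ge_p; rewrite leqNgt; apply/negP => lt_de.
have := mlead_supp p0; rewrite mcoeff_msupp ge_p ?eqxx //.
by rewrite hp ?mlead_supp.
Qed.

Lemma meval00E p : p.@[fun=> 0] = p@_0%MM.
Proof.
rewrite [in LHS](mpolyE p) [in RHS](mpolyE p) !raddf_sum; apply: eq_bigr => m _.
rewrite /= mevalZ mevalX mcoeffZ mcoeffX; congr (_ * _).
have [->|m0] := eqVneq m 0%MM.
  by rewrite big1 // => i _; rewrite mnm0E expr0.
have [i mi] : exists i, m i != 0%N.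
  apply/existsP; apply: contraNT m0 => /existsPn h.
  by apply/eqP/mnmP => i; rewrite mnm0E; apply/eqP; have := h i; rewrite negbK.
by rewrite (bigD1 i) //= expr0n (negbTE mi) mul0r.
Qed.

Lemma order_ge1 p : p.@[fun=> 0] = 0 -> order_ge 1 p.
Proof. by rewrite meval00E => p0 m; rewrite ltnS leqn0 mdeg_eq0 => /eqP->. Qed.

Lemma dhomog0_const p : p \is 0.-homog -> p = (p@_0%MM)%:MP.
Proof.
move=> /dhomogP hp; apply/mpolyP => m; rewrite mcoeffC.
have [->|m0] := eqVneq m 0%MM; first by rewrite mulr1.
rewrite mulr0; apply/eqP; rewrite mcoeff_eq0; apply/negP => /hp /eqP.
by rewrite mdeg_eq0 (negbTE m0).
Qed.

Lemma dhomog0_unit p : p \is 0.-homog -> p != 0 -> p \is a GRing.unit.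
Proof.
move=> /dhomog0_const pE p0; rewrite pE; apply: rmorph_unit.
by rewrite unitfE; apply: contraNneq p0 => p0; rewrite pE p0.
Qed.

(** The monomial order is compatible with addition, so the sum of the smallest monomials of [p] and
    [q] arises from that pair only. *)
Lemma mcoeff_mlastM p q :
  (p * q)@_(mlast p + mlast q) = p@_(mlast p) * q@_(mlast q).
Proof.
have [->|nz_p] := eqVneq p 0; first by rewrite mlast0 mul0r !mcoeff0 mul0r.
have [->|nz_q] := eqVneq q 0; first by rewrite mlast0 mulr0 !mcoeff0 mulr0.
rewrite mpolyME (bigD1_seq (mlast p, mlast q)) /=; first last.
+ by rewrite allpairs_uniq // => -[? ?] [].
+ by rewrite allpairs_f// !mlast_supp.
rewrite mcoeffD mcoeffZ mcoeffX eqxx mulr1.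
rewrite big_seq_cond raddf_sum /= big1 ?addr0 //.
move=> m /andP[/allpairsP[[m1 m2] [/= /mlast_lemc le1 /mlast_lemc le2 ->]] ne].
rewrite /= mcoeffZ mcoeffX.
rewrite -[(_ + _ == _)%MM]negbK; case: eqP => [e|]; last by rewrite mulr0.
suff : ((mlast p + mlast q)%MM < (m1 + m2)%MM)%O by rewrite e
  Order.POrderTheory.ltxx.
move: ne le1 le2; rewrite xpair_eqE !Order.POrderTheory.le_eqVlt.
move=> ne /predU1P[p1|lt1] /predU1P[q2|lt2].
- by rewrite p1 q2 !eqxx in ne.
- by rewrite p1 ltmc_add2r.
- by rewrite q2 ltmc_add2l.
- exact: ltm_add.
Qed.

(** The highest and the lowest degree are both additive on products, since the monomial order
    refines the degree. Both equal [d] on [p * q], which leaves no gap between them in either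
    factor. *)
Lemma dhomog_factor p q d : p * q != 0 -> p * q \is d.-homog ->
  exists2 e, (e <= d)%N & p \is e.-homog /\ q \is (d - e).-homog.
Proof.
move=> pq0 /dhomogP hpq.
have [p0 q0] : p != 0 /\ q != 0.
  by apply/andP; move: pq0; rewrite mulf_eq0 negb_or.
have dlead : (mdeg (mlead p) + mdeg (mlead q) = d)%N.
  by rewrite -mdegD -mleadM // hpq // mlead_supp.
have dlast : (mdeg (mlast p) + mdeg (mlast q) = d)%N.
  rewrite -mdegD hpq // mcoeff_msupp mcoeff_mlastM mulf_neq0 //.
    by rewrite -mcoeff_msupp mlast_supp.
  by rewrite -mcoeff_msupp mlast_supp.
have le r : r != 0 -> (mdeg (mlast r) <= mdeg (mlead r))%N.
  by move=> r0; apply/lemc_mdeg/mlast_lemc/mlead_supp.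
have hom r : mdeg (mlast r) = mdeg (mlead r) -> r \is (mdeg (mlead r)).-homog.
  move=> e; apply/dhomogP => m mr; apply/eqP; rewrite eqn_leq.
  by rewrite -{2}e !lemc_mdeg ?mlast_lemc ?msupp_le_mlead.
have eP : mdeg (mlast p) = mdeg (mlead p).
  apply/eqP; rewrite eqn_leq le //= -(leq_add2r (mdeg (mlead q))) dlead -dlast.
  by rewrite leq_add2l le.
have eQ : mdeg (mlast q) = mdeg (mlead q).
  by apply/eqP; rewrite -(eqn_add2l (mdeg (mlast p))) dlast eP dlead.
exists (mdeg (mlead p)); first by rewrite -dlead leq_addr.
by split; [exact: hom|rewrite -dlead addKn; exact: hom].
Qed.

Lemma pihomogM d e p q : p \is e.-homog ->
  pihomog mdeg d (p * q) = if (e <= d)%N then p * pihomog mdeg (d - e) q else 0.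
Proof.
move=> hp; have hq := pihomog_partitionE (leqnn (mmeasure mdeg q)).
have hk (k : nat) : pihomog mdeg d (p * pihomog mdeg k q) =
    if (e + k)%N == d then p * pihomog mdeg k q else 0.
  have hpk := dhomogM hp (pihomogP mdeg k q).
  case: eqVneq => [ed|ne]; first by rewrite pihomog_dE // -ed.
  by rewrite (pihomog_ne0 ne hpk).
rewrite [in LHS]hq mulr_sumr raddf_sum /=.
under eq_bigr => k _ do rewrite hk.
case: leqP => [le_ed|lt_de]; last first.
  rewrite big1 // => k _; case: eqP => // ek.
  by move: lt_de; rewrite -ek ltnNge leq_addr.
rewrite [in RHS]hq raddf_sum mulr_sumr; apply: eq_bigr => k _.
have -> : ((e + k)%N == d) = (k == d - e :> nat)%N.
  by rewrite -(eqn_add2l e k) subnKC.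
case: eqVneq => [<-|ne] /=; first by rewrite pihomog_id.
by rewrite (pihomog_ne0 ne (pihomogP _ _ _)) mulr0.
Qed.

Lemma pihomog0E p : pihomog mdeg 0 p = (p@_0%MM)%:MP.
Proof.
rewrite (dhomog0_const (pihomogP mdeg 0 p)); congr _%:MP.
have := pihomog_partitionE (leqnSn (mmeasure mdeg p)).
rewrite big_ord_recl => /(congr1 (mcoeff 0%MM)) pE; rewrite [RHS]pE.
rewrite mcoeffD [X in _ = _ + X]raddf_sum [X in _ = _ + X]big1 ?addr0 //= =>
  i _.
have /dhomogP h := pihomogP mdeg (bump 0 i) p.
by apply/eqP; rewrite mcoeff_eq0; apply/negP => /h /=; rewrite mdeg0.
Qed.

(** A factor of a homogeneous polynomial is homogeneous, and a nonzero constant term then forces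
    degree 0. *)
Lemma unit_of_dvd_homog d p q : p.@[fun=> 0] != 0 -> p * q != 0 ->
  p * q \is d.-homog -> p \is a GRing.unit.
Proof.
move=> p0 pq0 /(dhomog_factor pq0) [e _ [hp _]].
have pn0 : p != 0 by move: pq0; apply: contraNneq => ->; rewrite mul0r.
have e0 : e = 0%N.
  move: p0; rewrite meval00E -mcoeff_msupp => /(dhomog_mf hp) <-.
  exact: mdeg0.
by rewrite e0 in hp; exact: dhomog0_unit.
Qed.

Lemma unit_const p : p \is a GRing.unit -> exists2 c, c != 0 & p = c%:MP.
Proof.
rewrite unfold_in /= => /andP[/eqP pE]; rewrite unitfE => c0.
by exists p@_0%MM.
Qed.

Lemma pihomogM_const d p q : p \is d.-homog ->
  pihomog mdeg d (p * q) = p * (q.@[fun=> 0])%:MP.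
Proof. by move=> hp;
  rewrite (pihomogM d q hp) leqnn subnn pihomog0E meval00E. Qed.

End Polynomials.

(** * Modules of derivations and change of basis *)

Section Modules.

Variables (K : fieldType) (R : comNzRingType) (iota : K -> R).
Implicit Types (d : R -> R) (D : (R -> R) -> Prop).

(** Expresses being a submodule; arbitrary finite families match the expansions in [is_basis]. *)
Definition comb_closed D : Prop :=
  forall (I : finType) (c : I -> R) (th : I -> R -> R),
    (forall i, D (th i)) -> D (fun f => \sum_i c i * th i f).

Lemma derivation_comb : comb_closed (derivation iota).
Proof.
move=> I c th hth; split=> [f g|a f|f g].
- rewrite -big_split; apply: eq_bigr => i _; have [-> _ _] := hth i.
  by rewrite mulrDr.
- rewrite mulr_sumr; apply: eq_bigr => i _; have [_ -> _] := hth i.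
  by rewrite mulrCA.
- rewrite mulr_suml mulr_sumr -big_split; apply: eq_bigr => i _ /=.
  have [_ _ ->] := hth i; rewrite mulrDr mulrA; congr (_ + _).
  by rewrite mulrCA.
Qed.

Lemma Dmod_comb (T : choiceType) (A : {fset T}) (form : T -> R) (m : T -> nat) :
  comb_closed (Dmod iota A form m).
Proof.
move=> I c th hth; split; first by apply: derivation_comb => i; case: (hth i).
move=> H HA; have /fin_all_exists [g gE] (i : I) :
    exists g, th i (form H) = form H ^+ m H * g by have [_] := hth i; exact.
exists (\sum_i c i * g i); rewrite mulr_sumr; apply: eq_bigr => i _.
by rewrite gE mulrCA.
Qed.

Lemma comb_closed_scale D a d : comb_closed D -> D d -> D (fun f => a * d f).
Proof.
move=> DC Dd; have := DC unit (fun=> a) (fun=> d) (fun=> Dd).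
by congr D; apply/boolp.funext => f; rewrite big_const /= card_unit /= addr0.
Qed.

Lemma comb_closed_lin D a a' d d' : comb_closed D -> D d -> D d' ->
  D (fun f => a * d f + a' * d' f).
Proof.
move=> DC Dd Dd'; have -> : (fun f => a * d f + a' * d' f) =
    fun f => \sum_(b : bool) (if b then a else a') * (if b then d else d') f.
  by apply/boolp.funext => f; rewrite big_bool.
by apply: DC; case.
Qed.

Lemma is_basis_inj D (I : finType) (th : I -> R -> R) (c c' : I -> R) :
  is_basis D th -> (forall f, \sum_i c i * th i f = \sum_i c' i * th i f) ->
  forall i, c i = c' i.
Proof.
case=> _ _ free e i; apply/eqP; rewrite -subr_eq0; apply/eqP.
apply: (free (fun i => c i - c' i)) => f.
under eq_bigr do rewrite mulrBl.
by rewrite sumrB e subrr.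
Qed.

Lemma is_basis_iff D D' (I : finType) (th : I -> R -> R) :
  (forall d, D d <-> D' d) -> is_basis D th -> is_basis D' th.
Proof.
by move=> DD' [h1 h2 h3]; split=> // [i|d /DD']; [apply/DD'|exact: h2].
Qed.

End Modules.

Lemma is_basis_unitmx (R : comUnitRingType) (D : (R -> R) -> Prop) n
    (th h : 'I_n -> R -> R) (P : 'M[R]_n) :
  comb_closed D -> is_basis D th -> P \in unitmx ->
  (forall i f, h i f = \sum_j P i j * th j f) -> is_basis D h.
Proof.
move=> DC [Dth span free] uP hE.
have swap (c : 'I_n -> R) f : \sum_i c i * h i f =
    \sum_j ((\row_i c i) *m P) 0 j * th j f.
  under eq_bigr => i _ do rewrite hE mulr_sumr.
  rewrite exchange_big; apply: eq_bigr => j _; rewrite mxE mulr_suml.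
  by apply: eq_bigr => i _; rewrite mxE mulrA.
split=> [i|d /span [c dE]|c c0 i].
- have -> : h i = fun f => \sum_j P i j * th j f by apply/boolp.funext.
  exact: DC.
- exists (((\row_j c j) *m invmx P) 0) => f; rewrite dE swap.
  have -> : \row_i ((\row_j c j) *m invmx P) 0 i = (\row_j c j) *m invmx P.
    by apply/rowP => j; rewrite mxE.
  by rewrite mulmxKV //; apply: eq_bigr => j _; rewrite mxE.
- have cP0 : (\row_i c i) *m P = 0.
    by apply/rowP => j; rewrite [RHS]mxE; apply: free => f; rewrite -swap.
  have := congr1 (mulmx^~ (invmx P)) cP0; rewrite mulmxK // mul0mx.
  by move=> /rowP/(_ i); rewrite !mxE.
Qed.

(** * Derivations of the polynomial ring and homogeneous bases *)

Section PolynomialDerivations.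

Variables (n : nat) (K : fieldType).
Local Notation S := {mpoly K[n]}.
Local Notation der := (derivation (mpolyC n (R := K))).
Implicit Types (d : S -> S) (p q : S) (D : (S -> S) -> Prop).

(** Constants and variables generate the algebra, so an identity or congruence compatible with sums
    and products needs checking only there. *)
Lemma mpoly_alg_ind (P : S -> Prop) :
  (forall c, P c%:MP) -> (forall i, P 'X_i) ->
  (forall p q, P p -> P q -> P (p + q)) ->
  (forall p q, P p -> P q -> P (p * q)) -> forall p, P p.
Proof.
move=> hC hX hD hM; have h1 : P 1 by exact: (hC 1).
elim/mpolyind => [|c m p _ _ hp]; first by rewrite -mpolyC0.
apply: hD => //; rewrite -mul_mpolyC; apply: (hM) => //.
rewrite mpolyXE_id; apply: (big_ind P) => // i _.
by elim: (m i) => [|k ih]; rewrite ?expr0 // exprS; exact: hM.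
Qed.

Lemma derC d c : der d -> d c%:MP = 0.
Proof.
case=> _ dZ dM; rewrite -[c%:MP]mulr1 dZ; suff -> : d 1 = 0 by rewrite mulr0.
by apply: (addrI (d 1)); rewrite addr0 -{1}[d 1]mulr1 -{2}[d 1]mul1r -dM mulr1.
Qed.

Lemma der_coord (a : 'I_n -> S) : der (fun p => \sum_i a i * p^`M(i)).
Proof.
apply: derivation_comb => i; split=> [f g|c f|f g]; first exact: mderivD.
- exact: mderiv_mulC.
- exact: mderivM.
Qed.

Lemma coord_X (a : 'I_n -> S) j : \sum_i a i * ('X_j : S)^`M(i) = a j.
Proof.
rewrite (bigD1 j) //= big1 => [|i ij]; rewrite mderivX mnm1E.
  rewrite eqxx scale1r addr0.
  have -> : (U_(j) - U_(j) = 0)%MM by apply/mnmP => i; rewrite !mnmE subnn.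
  by rewrite mpolyX0 mulr1.
by rewrite eq_sym (negbTE ij) scale0r mulr0.
Qed.

Lemma der_ext d d' : der d -> der d' -> (forall i, d 'X_i = d' 'X_i) -> d =1 d'.
Proof.
move=> hd hd' dX; elim/mpoly_alg_ind => [c|i|p q|p q].
- by rewrite !derC.
- exact: dX.
- by case: hd hd' => [-> _ _] [-> _ _] -> ->.
- by case: hd hd' => [_ _ ->] [_ _ ->] -> ->.
Qed.

Lemma derE d p : der d -> d p = \sum_i d 'X_i * p^`M(i).
Proof.
move=> hd; apply: (der_ext hd (der_coord _)) => i.
by rewrite coord_X.
Qed.

Lemma der0 d : der d -> d 0 = 0.
Proof. by move=> /(derC 0); rewrite mpolyC0. Qed.

Definition der_homog (e : nat) d : S -> S :=
  fun p => \sum_i pihomog mdeg e (d 'X_i) * p^`M(i).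

(** For a basis of [D(A, m)] this is the Saito matrix. *)
Definition coef_mx k (th : 'I_k -> S -> S) : 'M[S]_(k, n) :=
  \matrix_(t, i) th t 'X_i.

Section FullRank.

Variables (D : (S -> S) -> Prop) (q : S).
Hypotheses (D_der : forall d, D d -> der d) (D_comb : comb_closed D).
Hypotheses (q0 : q != 0) (D_full : forall i, D (fun p => q * p^`M(i))).

(** Expanding [q] times each partial derivative, a member of [D], yields [B] with [B C = q], where
    [C] is the coefficient matrix. Then [C B C = q C], and independence of the basis cancels [C] on
    the right. *)
Lemma basis_coef_inv k (th : 'I_k -> S -> S) : is_basis D th ->
  exists B, B *m coef_mx th = q%:M /\ coef_mx th *m B = q%:M.
Proof.
move=> bth; have [Dth span _] := bth.
have /fin_all_exists [B hB] := fun i => span _ (D_full i).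
exists (\matrix_(i, t) B i t).
have BC : (\matrix_(i, t) B i t) *m coef_mx th = q%:M.
  apply/matrixP => i j; rewrite !mxE; under eq_bigr do rewrite !mxE.
  rewrite -hB mderivX mnm1E; case: (eqVneq j i) => [->|_].
    have -> : (U_(i) - U_(i) = 0)%MM by apply/mnmP => t; rewrite !mnmE subnn.
    by rewrite mpolyX0 scale1r mulr1.
  by rewrite scale0r mulr0.
split=> //; apply/matrixP => s t.
set CB := _ *m _;
  suff e f : \sum_t CB s t * th t f = \sum_t (q%:M : 'M_k) s t * th t f.
  exact: (is_basis_inj bth e).
have hd (M : 'M[S]_k) : der (fun f => \sum_t M s t * th t f).
  by apply: derivation_comb => j; apply: D_der.
apply: (der_ext (hd CB) (hd _)) => i.
have e (M : 'M[S]_k) : \sum_t M s t * th t 'X_i = (M *m coef_mx th) s i.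
  by rewrite mxE; apply: eq_bigr => j _; rewrite mxE.
by rewrite !e -mulmxA BC mul_scalar_mx mul_mx_scalar.
Qed.

(** Over the fraction field the coefficient matrix gets an inverse on both sides, hence is
    square. *)
Lemma basis_size k (th : 'I_k -> S -> S) : is_basis D th -> k = n.
Proof.
case/basis_coef_inv => B [BC CB].
have q0' : tofrac q != 0 by rewrite tofrac_eq0.
have le a b (M : 'M[S]_(a, b)) (N : 'M[S]_(b, a)) : M *m N = q%:M -> (a <= b)%N.
  move=> /(congr1 (map_mx (@tofrac S))); rewrite map_mxM map_scalar_mx => MN.
  apply: (@mulmx1_min _ _ _ ((tofrac q)^-1 *: map_mx (@tofrac S) M) (map_mx
    (@tofrac S) N)).
  by rewrite -scalemxAl MN scale_scalar_mx mulVf.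
by apply/eqP; rewrite eqn_leq (le _ _ _ _ BC) (le _ _ _ _ CB).
Qed.

Lemma basis_det_neq0 (th : 'I_n -> S -> S) : is_basis D th ->
  \det (coef_mx th) != 0.
Proof.
case/basis_coef_inv => B [_ CB]; have := congr1 determinant CB.
rewrite det_mulmx det_scalar => e; have := expf_neq0 n q0.
by rewrite -e; apply: contraNneq => ->; rewrite mul0r.
Qed.

(* Among the homogeneous components of the members of a basis, multilinearity of
   the determinant selects n ones whose transition matrix to the basis is
   invertible at the origin. Its determinant divides a homogeneous polynomial,
   hence is a constant. *)
Lemma homog_basis (th : 'I_n -> S -> S) :
  (forall e d, D d -> D (der_homog e d)) -> is_basis D th ->
  exists h (dg : 'I_n -> nat),
    is_basis D h /\ forall i j, h i 'X_j \is (dg i).-homog.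
Proof.
move=> D_homog bth; have [Dth span _] := bth.
pose N := (\max_i \max_j mmeasure mdeg (th i 'X_j))%N.
have dec i p : th i p = \sum_(e < N) der_homog e (th i) p.
  rewrite derE; last exact/D_der.
  rewrite exchange_big; apply: eq_bigr => j _; rewrite -mulr_suml;
    congr (_ * _).
  apply: pihomog_partitionE; apply: leq_trans (leq_bigmax i).
  exact: (leq_bigmax (F := fun j => mmeasure mdeg (th i 'X_j)) j).
have /fin_all_exists [C hC] (ie : 'I_n * 'I_N) :
    exists c : 'I_n -> S,
      forall f, der_homog ie.2 (th ie.1) f = \sum_j c j * th j f.
  by apply/span/D_homog.
(* The components of [th i] add up to [th i], so by uniqueness of coefficients their coefficient
   rows add up to a row of the identity matrix. *)
have sumC i j : \sum_(e < N) C (i, e) j = (i == j)%:R.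
  apply: (is_basis_inj (c := fun j => \sum_(e < N) C (i, e) j)
    (c' := fun j => (i == j)%:R) bth) => f.
  rewrite [RHS](bigD1 i) //= [X in _ = _ + X]big1 => [|t ti]; last first.
    by rewrite /= eq_sym (negbTE ti) mul0r.
  rewrite eqxx mul1r addr0 dec; under eq_bigr do rewrite mulr_suml.
  by rewrite exchange_big; apply: eq_bigr => e _; rewrite (hC (i, e)).
pose M (F : {ffun 'I_n -> 'I_N}) : 'M[S]_n := \matrix_(i, j) C (i, F i) j.
have sumM : \sum_F \det (M F) = 1.
  transitivity (\det (1%:M : 'M[S]_n)); last exact: det1.
  rewrite /determinant exchange_big; apply: eq_bigr => s _ /=;
    rewrite -mulr_sumr; congr (_ * _).
  rewrite (eq_bigr (fun F : {ffun 'I_n -> 'I_N} =>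
    \prod_i C (i, F i) (s i))) => [|F _]; last first.
    by apply: eq_bigr => i _; rewrite mxE.
  rewrite -(bigA_distr_bigA (fun i e => C (i, e) (s i))).
  by apply: eq_bigr => i _; rewrite sumC mxE.
have [F F0] : exists F, (\det (M F)).@[fun=> 0] != 0.
  apply/existsP; apply: contra_eqT sumM => /existsPn h.
  apply/negP => /eqP /(congr1 (meval (fun=> 0))); rewrite raddf_sum /= big1.
    by move/eqP; rewrite meval1 eq_sym oner_eq0.
  by move=> F _; apply/eqP; have := h F; rewrite negbK.
pose h i := der_homog (F i) (th i).
have hE i f : h i f = \sum_j M F i j * th j f.
  by rewrite /h (hC (i, F i)); apply: eq_bigr => j _; rewrite mxE.
have hX i j : h i 'X_j \is (F i).-homog.
  by rewrite /h /der_homog coord_X pihomogP.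
have detE : \det (coef_mx h) = \det (M F) * \det (coef_mx th).
  rewrite -det_mulmx; congr determinant; apply/matrixP => i j.
  by rewrite !mxE hE; apply: eq_bigr => k _; rewrite !mxE.
exists h, (fun i => F i); split=> //.
apply: (is_basis_unitmx D_comb bth _ hE).
rewrite unitmxE; apply: (unit_of_dvd_homog (q := \det (coef_mx th)) (d :=
  \sum_i F i) F0).
  rewrite mulf_neq0 ?basis_det_neq0 //.
  by apply: contraNneq F0 => ->; rewrite meval0.
rewrite -detE; apply: rpred_sum => s _.
have hs : \prod_i coef_mx h i (s i) \is (\sum_i F i)%N.-homog.
  apply: (big_ind2 (fun e p => p \is e.-homog)) => [|e1 p1 e2 p2|i _].
  - exact: dhomog1.
  - by move=> h1 h2; apply: dhomogM.
  - by rewrite mxE.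
by rewrite mulr_sign; case: ifP => // _; rewrite dhomogN.
Qed.

End FullRank.
End PolynomialDerivations.

(** * Divisibility by linear forms *)

Definition divides (R : comNzRingType) (a p : R) : Prop := exists g, p = a * g.

Lemma divides_mulr (R : comNzRingType) (a p q : R) :
  divides a p -> divides a (p * q).
Proof. by case=> g ->; exists (g * q); rewrite mulrA. Qed.

Lemma divides_mull (R : comNzRingType) (a p q : R) :
  divides a p -> divides a (q * p).
Proof. by rewrite mulrC; apply: divides_mulr. Qed.

Lemma divides_sum (R : comNzRingType) (a : R) (I : finType) (P : pred I)
    (F : I -> R) :
  (forall i, P i -> divides a (F i)) -> divides a (\sum_(i | P i) F i).
Proof.
move=> hF; apply: (big_ind (divides a)) => //; first by exists 0; rewrite mulr0.
by move=> _ _ [g ->] [h ->]; exists (g + h); rewrite mulrDr.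
Qed.

Lemma dividesD (R : comNzRingType) (a p q : R) :
  divides a p -> divides a q -> divides a (p + q).
Proof. by case=> g -> [h ->]; exists (g + h); rewrite mulrDr. Qed.

Lemma dividesN (R : comNzRingType) (a p : R) : divides a p -> divides a (- p).
Proof. by case=> g ->; exists (- g); rewrite mulrN. Qed.

Lemma divides_exp (R : comNzRingType) (a : R) (i j : nat) (p : R) :
  (i <= j)%N -> divides (a ^+ j) p -> divides (a ^+ i) p.
Proof.
by move=> ij [g ->]; exists (a ^+ (j - i) * g); rewrite mulrA -exprD subnKC.
Qed.

Section LinearForms.

Variables (K : fieldType) (V : vectType K) (l : nat) (b : l.-tuple V).
Hypothesis hb : basis_of fullv b.
Local Notation S := {mpoly K[l]}.
Local Notation form := 'Hom(V, K^o).
Implicit Types (f g : form) (v x : V) (p q : S).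
Local Notation L := (lform b).
Local Notation der := (derivation (mpolyC l (R := K))).

Lemma lform_comb (a c : K) f g : L (a *: f + c *: g) = a *: L f + c *: L g.
Proof.
rewrite /lform !scaler_sumr -big_split; apply: eq_bigr => i _ /=.
by rewrite !lfunE /= !lfunE /= scalerDl !scalerA.
Qed.

Lemma lform_meval f x : (L f).@[fun i => coord b i x] = f x.
Proof.
rewrite {2}(coord_basis hb (memvf x)) linear_sum raddf_sum; apply: eq_bigr =>
  i _.
by rewrite /= mevalZ mevalXU linearZ /= mulrC.
Qed.

Lemma lform_homog f : L f \is 1.-homog.
Proof.
apply: rpred_sum => i _; apply: dhomogZ.
by rewrite dhomogX /= mdeg1.
Qed.

Lemma lform_neq0 f v : f v != 0 -> L f != 0.
Proof. by rewrite -lform_meval; apply: contraNneq => ->; rewrite meval0. Qed.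

Lemma divides_lform_lker f g : divides (L f) (L g) -> (lker f <= lker g)%VS.
Proof.
case=> h gE; apply/subvP => x; rewrite !memv_ker -!lform_meval gE mevalM.
by move=> /eqP->; rewrite mul0r.
Qed.

Lemma der_lform d f : der d -> d (L f) = \sum_(i < l) f b`_i *: d 'X_i.
Proof.
move=> hd; rewrite /lform.
have dZ c p : d (c *: p) = c *: d p by case: hd => _ h _;
  rewrite -!mul_mpolyC h.
have dD p q : d (p + q) = d p + d q by case: hd.
rewrite (big_morph d dD (der0 hd)); apply: eq_bigr => i _; exact: dZ.
Qed.

Lemma der_lform_comb d (a c : K) f g : der d ->
  d (a *: L f + c *: L g) = a *: d (L f) + c *: d (L g).
Proof. by case=> dD dZ _; rewrite dD -!mul_mpolyC !dZ. Qed.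

Lemma partial_der v : der (partial b v).
Proof.
have := der_coord (fun i => (coord b i v)%:MP : S).
by congr derivation; apply/boolp.funext => p; apply: eq_bigr => i _;
  rewrite mul_mpolyC.
Qed.

(* The endomorphism of S dual to the projection of V onto lker f along v. *)
Definition lsubst v f : S -> S :=
  comp_mpoly [tuple 'X_i - coord b i v *: L f | i < l].

HB.instance Definition _ v f := GRing.RMorphism.on (lsubst v f).

Lemma lsubstC v f c : lsubst v f c%:MP = c%:MP.
Proof. exact: comp_mpolyC. Qed.

Lemma lsubstX v f i : lsubst v f 'X_i = 'X_i - coord b i v *: L f.
Proof. by rewrite /lsubst comp_mpolyXU -tnth_nth tnth_mktuple. Qed.

Lemma lsubst_lform v f g : lsubst v f (L g) = L g - g v *: L f.
Proof.
rewrite {1 2}/lform rmorph_sum /=.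
have -> : g v = \sum_(i < l) coord b i v * (g b`_i : K) :> K.
  rewrite {1}(coord_basis hb (memvf v)) linear_sum.
  by apply: eq_bigr => i _; rewrite linearZ.
rewrite scaler_suml -sumrB; apply: eq_bigr => i _.
rewrite -mul_mpolyC rmorphM /= lsubstC lsubstX.
by rewrite !mul_mpolyC scalerBr scalerA [_ * coord _ _ _]mulrC.
Qed.

Lemma lsubst_lform_orth v f g : g v = 0 -> lsubst v f (L g) = L g.
Proof. by move=> gv; rewrite lsubst_lform gv scale0r subr0. Qed.

Lemma lsubst_lform0 v f : f v = 1 -> lsubst v f (L f) = 0.
Proof. by move=> fv; rewrite lsubst_lform fv scale1r subrr. Qed.

Lemma lsubst_mod v f p : divides (L f) (p - lsubst v f p).
Proof.
elim/mpoly_alg_ind: p => [c|i|p q [g gE] [h hE]|p q [g gE] [h hE]].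
- by exists 0; rewrite lsubstC subrr mulr0.
- exists (coord b i v)%:MP; rewrite lsubstX opprB addrC subrK.
  by rewrite -mul_mpolyC mulrC.
- by exists (g + h); rewrite rmorphD opprD addrACA gE hE mulrDr.
- exists (g * q + lsubst v f p * h);
  rewrite rmorphM mulrDr mulrA -gE mulrCA -hE.
  by rewrite mulrBl mulrBr addrA subrK.
Qed.

(** The substitution kills [L f] and changes [p] by a multiple of [L f]. It thus embeds the quotient
    by [L f] into the domain [S]; this is why [L f] is prime. *)
Lemma lsubst_eq0 v f p : f v = 1 -> lsubst v f p = 0 <-> divides (L f) p.
Proof.
move=> fv; split=> [p0|[g ->]];
  last by rewrite rmorphM /= lsubst_lform0 // mul0r.
by have := lsubst_mod v f p; rewrite p0 subr0.
Qed.

Lemma lform_dual f v : f v != 0 -> exists2 w, f w = 1 & w = (f v)^-1 *: v.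
Proof. by move=> fv; exists ((f v)^-1 *: v);
  rewrite // linearZ /= [_ *: _]mulVf. Qed.

Lemma lform_prime f v p q : f v != 0 -> divides (L f) (p * q) ->
  divides (L f) p \/ divides (L f) q.
Proof.
move=> /lform_dual [w fw _] /(lsubst_eq0 _ fw) /eqP; rewrite rmorphM mulf_eq0.
by case/orP => /eqP /(lsubst_eq0 _ fw); [left|right].
Qed.

(** Each step of the induction cancels one factor [L f]: it is prime and does not divide [u], so it
    divides [p]. *)
Lemma lform_exp_prime f v u p k : f v != 0 -> ~ divides (L f) u ->
  divides (L f ^+ k) (u * p) -> divides (L f ^+ k) p.
Proof.
move=> fv nu; have f0 := lform_neq0 fv.
elim: k p => [|k ih] p; first by exists p; rewrite expr0 mul1r.
case=> g; rewrite exprS -mulrA => e.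
have /(lform_prime fv) [//|[h pE]] : divides (L f) (u * p).
  by exists (L f ^+ k * g).
have /ih [h' hE] : divides (L f ^+ k) (u * h).
  by exists g; apply: (mulfI f0); rewrite -e pE mulrCA.
by exists h'; rewrite pE hE mulrA.
Qed.

Lemma lform_prime_prod f v (T : eqType) (r : seq T) (P : pred T) (F : T -> S) :
  f v != 0 -> (forall H, H \in r -> P H -> ~ divides (L f) (F H)) ->
  ~ divides (L f) (\prod_(H <- r | P H) F H).
Proof.
move=> fv hF; rewrite big_seq_cond.
apply: (big_ind (fun p => ~ divides (L f) p)) =>
  [d1|p q np nq /(lform_prime fv) []//|H].
  have /lsubst_eq0 : divides (L f) 1 := d1.
  have [w fw _] := lform_dual fv; move=> /(_ w fw) /eqP.
  by rewrite rmorph1 oner_eq0.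
by case/andP; exact: hF.
Qed.

Lemma lform_not_divides_exp f v u k :
  f v != 0 -> ~ divides (L f) u -> ~ divides (L f) (u ^+ k).
Proof.
move=> fv nu; have := @lform_prime_prod f v _ (iota 0 k) predT (fun=> u) fv.
by rewrite big_const_seq count_predT size_iota -Monoid.iteropE; apply.
Qed.

End LinearForms.

(** * Existence of an adapted basis *)

Lemma sum_scalar_mx (R : comNzRingType) n (a : R) s (F : 'I_n -> R) :
  \sum_j (a%:M : 'M[R]_n) s j * F j = a * F s.
Proof.
rewrite (bigD1 s) //= big1 => [|j js]; first by rewrite mxE eqxx mulr1n addr0.
by rewrite mxE eq_sym (negbTE js) mul0r.
Qed.

Section FreePair.

Variables (K : fieldType) (V : vectType K) (l : nat) (b : l.-tuple V).
Hypothesis hb : basis_of fullv b.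
Local Notation S := {mpoly K[l]}.
Local Notation L := (lform b).
Local Notation der := (derivation (mpolyC l (R := K))).
Implicit Types (H X : {vspace V}).

Variables (A : {fset {vspace V}}) (alpha : {vspace V} -> 'Hom(V, K^o)).
Hypothesis dim_hyp : forall H, H \in A -> (\dim H).+1 = \dim {:V}.
Hypothesis lker_alpha : forall H, H \in A -> lker (alpha H) = H.

Let form H := L (alpha H).

Lemma alpha_nonzero H : H \in A -> exists v, alpha H v != 0.
Proof.
move=> HA; have : ~~ (fullv <= H)%VS.
  by apply/negP => /dimvS; rewrite -(dim_hyp HA) ltnn.
by case/subvPn => v _; rewrite -{1}(lker_alpha HA) memv_ker; exists v.
Qed.

Lemma hyperplane_eq H H' : H \in A -> H' \in A -> (H <= H')%VS -> H = H'.
Proof.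
move=> HA HA' /dimv_leqif_eq [_ e]; apply/eqP.
by rewrite -e -eqSS !dim_hyp.
Qed.

Lemma form_not_divides H H' : H \in A -> H' \in A -> H != H' ->
  ~ divides (form H) (form H').
Proof.
move=> HA HA' /eqP ne /(divides_lform_lker hb).
by rewrite !lker_alpha // => /(hyperplane_eq HA HA').
Qed.

(** Linear forms have constant coefficients, so taking components commutes with evaluating a
    derivation on them. Divisibility by the homogeneous [alpha_H ^ m(H)] passes to components. *)
Lemma DS_homog (m : {vspace V} -> nat) e d :
  DS A form m d -> DS A form m (der_homog e d).
Proof.
move=> [hd dA]; split=> [|H HA]; first exact: der_coord.
have -> : der_homog e d (form H) = pihomog mdeg e (d (form H)).
  rewrite !der_lform //; last exact: der_coord.
  by rewrite linear_sum; apply: eq_bigr => i _;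
    rewrite linearZ /= /der_homog coord_X.
have [g ->] := dA H HA.
rewrite (pihomogM _ _ (dhomogMn (m H) (lform_homog b (alpha H)))).
by case: ifP => _; [exists (pihomog mdeg (e - 1 * m H) g)|exists 0;
  rewrite mulr0].
Qed.

(** The defining polynomial of the multiarrangement [(B, m)]. *)
Definition arr_prod (B : {fset {vspace V}}) (m : {vspace V} -> nat) : S :=
  \prod_(H <- B) form H ^+ m H.

Lemma divides_arr_prod (B : {fset {vspace V}}) m H :
  H \in B -> divides (form H ^+ m H) (arr_prod B m).
Proof. by move=> HB; rewrite /arr_prod (big_fsetD1 H) //; eexists. Qed.

Lemma arr_prod_neq0 m : arr_prod A m != 0.
Proof.
rewrite /arr_prod big_seq_cond; apply: (big_ind (fun p : S => p != 0)).
- exact: oner_neq0.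
- by move=> p q; exact: mulf_neq0.
move=> H /andP[/alpha_nonzero [v hv] _].
by rewrite expf_neq0 // (lform_neq0 hb hv).
Qed.

Lemma not_divides_arr_prod (B : {fset {vspace V}}) m H : H \in A ->
  {subset B <= A} -> H \notin B -> ~ divides (form H) (arr_prod B m).
Proof.
move=> HA BA HB; have [v hv] := alpha_nonzero HA.
apply: (lform_prime_prod hb hv) => H' HB' _.
apply: (lform_not_divides_exp hb hv); apply: form_not_divides => //.
  exact: BA.
by apply: contraNneq HB => ->.
Qed.

Lemma DS_scale m a d : der d ->
  (forall H, H \in A -> divides (form H ^+ m H) (a * d (form H))) ->
  DS A form m (fun p => a * d p).
Proof. by move=> hd hA; split=> //; apply: comb_closed_scale hd;
  exact: derivation_comb. Qed.

Lemma DS_full m i : DS A form m (fun p => arr_prod A m * p^`M(i)).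
Proof.
apply: DS_scale => [|H HA]; last exact/divides_mulr/divides_arr_prod.
split=> [f g|c f|f g]; first exact: mderivD.
- exact: mderiv_mulC.
- exact: mderivM.
Qed.

(** [free_module] leaves the number of basis elements open; containing a nonzero multiple of every
    partial derivative fixes it. *)
Lemma DS_basis_size m k (th : 'I_k -> S -> S) :
  is_basis (DS A form m) th -> k = l.
Proof.
have Dder d : DS A form m d -> der d by case.
exact: (basis_size Dder (arr_prod_neq0 m) (DS_full m)).
Qed.

Lemma DS_homog_basis m : free_module (DS A form m) ->
  exists (th : 'I_l -> S -> S) (dg : 'I_l -> nat),
    is_basis (DS A form m) th /\ forall i j, th i 'X_j \is (dg i).-homog.
Proof.
case=> k [th bth]; have kl := DS_basis_size bth; subst k.
have Dder d : DS A form m d -> der d by case.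
apply: (homog_basis Dder _ (arr_prod_neq0 m) (DS_full m) _ bth).
  exact: Dmod_comb.
exact: DS_homog.
Qed.

Variables (m : {vspace V} -> nat) (H0 : {vspace V}).
Hypotheses (H0A : H0 \in A) (mH0 : (0 < m H0)%N).

Let a0 := form H0.
Let D := DS A form m.
Let D' := DS A form (del_mult m H0).

(** If [m H0 = 1], the reduced multiplicity of [H0] is 0 and its condition is vacuous. Both cases of
    the deletion can therefore be treated over [A]. *)
Lemma DS_del_arr d : DS (del_arr A m H0) form (del_mult m H0) d <-> D' d.
Proof.
split=> -[hd dA]; split=> // H HA; last first.
  by apply: dA; move: HA; rewrite /del_arr; case: ifP => // _ /fsetD1P[].
have [HB|] := boolP (H \in del_arr A m H0); first exact: dA.
rewrite /del_arr; case: eqP => [m1|]; last by rewrite HA.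
rewrite in_fsetD1 HA andbT negbK => /eqP ->.
by exists (d (form H0)); rewrite /del_mult eqxx m1 expr0 mul1r.
Qed.

Lemma del_memP d : D d <-> D' d /\ divides (a0 ^+ m H0) (d a0).
Proof.
split=> [[hd dA]|[[hd dA] d0]].
  split; last exact: dA.
  split=> // H HA; have := dA H HA; apply: divides_exp.
  by rewrite /del_mult; case: eqP => // ->; rewrite leq_pred.
split=> [//|H HA]; have := dA H HA; rewrite /del_mult.
by case: eqP => [->|].
Qed.

Lemma scale_del_mem d : D' d -> D (scale_der a0 d).
Proof.
move=> hd; apply/del_memP; split.
  apply: (comb_closed_scale (D := D')) => //; exact: Dmod_comb.
have [_ /(_ _ H0A) [g gE]] := hd.
exists g; rewrite /scale_der gE /del_mult eqxx mulrA -exprS prednK //.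
Qed.

(** Take [a0 ^ (m(H_0) - 1) Q] times the derivative along some [v] with [alpha_0(v) = 1]. It maps
    [a0] to [a0 ^ (m(H_0) - 1) Q], and [a0] does not divide [Q]. *)
Lemma exists_del_not_mem : exists2 d, D' d & ~ D d.
Proof.
have [v' hv'] := alpha_nonzero H0A; have [v hv _] := lform_dual hv'.
pose Q := arr_prod (A `\ H0) m.
exists (fun p => (a0 ^+ (m H0).-1 * Q) * partial b v p).
  apply: DS_scale => [|H HA]; first exact: partial_der.
  apply: divides_mulr; rewrite /del_mult; case: eqP => [->|/eqP ne].
    by exists Q.
  by apply/divides_mull/divides_arr_prod/fsetD1P.
case/del_memP => _ [g]; rewrite partial_lform // hv mulr1.
rewrite -[in RHS](prednK mH0) exprSr -mulrA.
have a00 : a0 != 0 by apply: (lform_neq0 hb hv').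
move=> /(mulfI (expf_neq0 _ a00)) QE.
apply: (@not_divides_arr_prod (A `\ H0) m H0) => //.
- by move=> H /fsetD1P[].
- by rewrite in_fsetD1 eqxx.
by exists g.
Qed.

Lemma exists_adapted : free_module D -> free_module D' ->
  exists (th : 'I_l -> S -> S) (k : 'I_l), is_basis D' th /\
    is_basis D (fun i => if i == k then scale_der a0 (th k) else th i).
Proof.
have D'C : comb_closed D' by exact: Dmod_comb.
have DC : comb_closed D by exact: Dmod_comb.
case=> l' [phi bphi]; have ll' := DS_basis_size bphi; subst l'.
case/DS_homog_basis => th [dg [bth thX]].
have [v' hv'] := alpha_nonzero H0A.
have a00 : a0 != 0 by apply: (lform_neq0 hb hv').
have [Dphi spanD freeD] := bphi; have [Dth spanD' freeD'] := bth.
have [wt wtD' wtD] := exists_del_not_mem.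
have /fin_all_exists [P hP] (i : 'I_l) :
    exists c : 'I_l -> S, forall f, phi i f = \sum_j c j * th j f.
  by apply: spanD'; have [] := (del_memP (phi i)).1 (Dphi i).
have /fin_all_exists [R hR] (i : 'I_l) :
    exists c : 'I_l -> S, forall f, a0 * th i f = \sum_j c j * phi j f.
  exact: (spanD _ (scale_del_mem (Dth i))).
have [i [k Rki]] : exists i k, (R k i).@[fun=> 0] != 0.
  apply/boolp.not_existsP => Rnone; have R0 k i : (R k i).@[fun=> 0] = 0.
    by apply/eqP; apply/negP => /negP ne; apply: (Rnone i); exists k.
  pose Pm : 'M[S]_l := \matrix_(i, j) P i j.
  pose Rm : 'M[S]_l := \matrix_(i, j) R i j.
  (* Going from [a0 th] to [phi] and back to [th] amounts to multiplication by [a0]. *)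
  have RP : Rm *m Pm = a0%:M.
    apply/matrixP => s t.
    apply: (is_basis_inj (c := (Rm *m Pm) s) (c' := (a0%:M : 'M_l) s) bth) => f.
    rewrite sum_scalar_mx hR.
    under eq_bigr do rewrite mxE mulr_suml.
    rewrite exchange_big; apply: eq_bigr => j _ /=; rewrite hP mulr_sumr.
    by apply: eq_bigr => t' _; rewrite !mxE mulrA.
  have := congr1 determinant RP; rewrite det_mulmx det_scalar => detRP.
  have RP0 : \det Rm * \det Pm != 0 by rewrite detRP expf_neq0.
  have a0l : \det Rm * \det Pm \is l.-homog.
    rewrite detRP -[l in l.-homog]mul1n; apply: dhomogMn; exact: lform_homog.
  have [e le_el [hR' hP']] := dhomog_factor RP0 a0l.
  have {}hP' : \det Pm \is 0.-homog.
    have : (l <= e)%N.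
      apply: (order_ge_leq hR'); first by apply: contraNneq RP0 => ->;
        rewrite mul0r.
      apply: order_ge_sum => s.
      (* The sign contributes order 0, the product of [l] entries order at least [l]. *)
      apply: (@order_geM _ _ 0 l); first exact: order_ge0.
      have := @order_ge_prod _ K 'I_l (fun t => Rm t (s t)); rewrite card_ord;
        apply.
      by move=> t; rewrite mxE; apply: order_ge1.
    by move: hP'; rewrite -subn_eq0 => + /eqP e0; rewrite e0.
  have uP : Pm \in unitmx.
    by rewrite unitmxE; apply: dhomog0_unit => //; apply: contraNneq RP0 => ->;
      rewrite mulr0.
  (* With [Pm] invertible, [th] is a basis of [D] as well, which puts [wt] in [D]. *)
  have bD : is_basis D th.
    apply: (is_basis_unitmx (P := invmx Pm) DC bphi);
      first by rewrite unitmx_inv.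
    move=> s f; have := mulVmx uP; move=> /matrixP/(_ s) e1.
    transitivity (\sum_t (1%:M : 'M[S]_l) s t * th t f).
      by rewrite sum_scalar_mx mul1r.
    under eq_bigr do rewrite -e1 mxE mulr_suml.
    rewrite exchange_big; apply: eq_bigr => j _ /=; rewrite hP mulr_sumr.
    by apply: eq_bigr => t' _; rewrite !mxE mulrA.
  have [c wE] := spanD' _ wtD'; case: wtD.
  have -> : wt = fun f => \sum_i c i * th i f by apply/boolp.funext.
  by apply: DC; case: bD.
have /fin_all_exists [v vE] (j : 'I_l) :
    exists g, th j a0 = a0 ^+ (m H0).-1 * g.
  by have [_ /(_ _ H0A)] := Dth j; rewrite /del_mult eqxx.
have v_homog j : exists e, v j \is e.-homog.
  have [->|v0] := eqVneq (v j) 0; first by exists 0%N; exact: dhomog0.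
  have : a0 ^+ (m H0).-1 * v j \is (dg j).-homog.
    rewrite -vE der_lform; last by case: (Dth j).
    apply: rpred_sum => t _; apply: dhomogZ. exact: thX.
  case/dhomog_factor; first by rewrite mulf_neq0 // expf_neq0.
  by move=> e _ [_ ?]; exists (dg j - e)%N.
have a0_pred (g : S) : a0 ^+ (m H0).-1 * (a0 * g) = a0 ^+ m H0 * g.
  by rewrite mulrA -exprSr prednK.
have /fin_all_exists [c hc] (j : 'I_l) : exists c, divides a0 (v j - c * v k).
  have wD : D (fun f => v j * th k f + (- v k) * th j f).
    apply/del_memP; split;
      first exact: (comb_closed_lin _ _ D'C (Dth k) (Dth j)).
    by exists 0; rewrite !vE mulr0 mulNr mulrCA [v k * (_ * _)]mulrCA [v k *
      _]mulrC subrr.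
  have [w wE] := spanD _ wD.
  (* Two expansions of [a0] times the derivation; the coefficients at [i] give
     [v_j R_ki - v_k R_ji = a0 w_i]. *)
  have e f : \sum_i (v j * R k i - v k * R j i) * phi i f = \sum_i (a0 * w i) *
    phi i f.
    rewrite (eq_bigr (fun i =>
      v j * (R k i * phi i f) - v k * (R j i * phi i f))) => [|t _].
      rewrite sumrB -!mulr_sumr -!hR mulrCA [v k * _]mulrCA -mulrBr -mulNr wE.
      by rewrite mulr_sumr; apply: eq_bigr => t _; rewrite mulrA.
    by rewrite mulrBl !mulrA.
  have {e} := is_basis_inj bphi e i; have [d vd] := v_homog j;
    have [d' vd'] := v_homog k.
  (* In the degree of [v_j] the first product leaves [v_j] times the value of [R_ki] at the origin.
     The other two stay multiples of [v_k] and [a0], which are homogeneous. Dividing by the nonzero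
     constant [u] gives the coefficient. *)
  move=> /(congr1 (pihomog mdeg d)); rewrite raddfB /= pihomogM_const //.
  have [s ->] : divides (v k) (pihomog mdeg d (v k * R j i)).
    rewrite (pihomogM _ _ vd'); case: ifP => _; first by eexists.
    by exists 0; rewrite mulr0.
  have [g ->] : divides a0 (pihomog mdeg d (a0 * w i)).
    rewrite (pihomogM _ _ (lform_homog b _)); case: ifP => _; first by eexists.
    by exists 0; rewrite mulr0.
  set u := (R k i).@[_] => e.
  exists (s * u^-1%:MP); exists (g * u^-1%:MP).
  have uV : u%:MP * u^-1%:MP = 1 :> S by rewrite -mpolyCM mulfV.
  rewrite [RHS]mulrA -e mulrBl -!mulrA uV mulr1; congr (_ - _).
  by rewrite [_ * v k]mulrC mulrCA.
(* Otherwise [a0] would divide every [v_j], and [D'] would be contained in [D]. *)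
have vk : ~ divides a0 (v k).
  move=> [g gE]; have [w wE] := spanD' _ wtD'; apply: wtD; apply/del_memP;
    split=> //.
  rewrite wE; apply: divides_sum => j _; apply: divides_mull; rewrite vE.
  have [g' vjE] := hc j; exists (g' + c j * g); rewrite -a0_pred mulrDr -vjE.
  by rewrite [a0 * _]mulrCA -gE subrK.
(* [N] is supported in column [k] off the diagonal, so its square is 0 and [1 - N] has inverse
   [1 + N]. *)
pose N : 'M[S]_l := \matrix_(s, t) if (s != k) && (t == k) then c s else 0.
pose th' s f := \sum_t (1%:M - N) s t * th t f.
have uN : 1%:M - N \in unitmx.
  suff /mulmx1_unit [-> _] : (1%:M - N) *m (1%:M + N) = 1%:M by [].
  suff NN : N *m N = 0 by rewrite mulmxDr mulmxBl !mulmx1 mulmxBl mul1mx NN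
    subr0 subrK.
  apply/matrixP => s t; rewrite !mxE big1 // => j _; rewrite !mxE.
  by case: (eqVneq j k) => [->|_]; rewrite ?eqxx /= ?andbF ?mulr0 ?mul0r.
have bth' : is_basis D' th' by exact: is_basis_unitmx bth uN _.
have th'E s f : th' s f = th s f - (if s != k then c s else 0) * th k f.
  have NE t : (1%:M - N) s t = 1%:M s t - N s t by rewrite !mxE.
  rewrite /th'; under eq_bigr do rewrite NE mulrBl.
  rewrite sumrB sum_scalar_mx mul1r; congr (_ - _).
  rewrite (bigD1 k) //= big1 => [|j js];
    last by rewrite mxE (negbTE js) andbF mul0r.
  by rewrite mxE eqxx andbT addr0.
exists th', k; split=> //.
have th'k f : th' k f = th k f by rewrite th'E eqxx mul0r subr0.
have th'_a0 j : j != k -> divides (a0 ^+ m H0) (th' j a0).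
  move=> jk; have [g gE] := hc j; exists g.
  by rewrite th'E jk !vE mulrCA -mulrBr gE a0_pred.
have [Dth' span' free'] := bth'.
split=> [j|d Dd|w w0 i0].
- case: eqP => [_|/eqP jk]; first exact: scale_del_mem.
  by apply/del_memP; split; [exact: Dth'|exact: th'_a0].
- have [d' d0] := (del_memP d).1 Dd; have [w wE] := span' _ d'.
  (* In the expansion of [d a0], all terms but the [k]-th are divisible by [a0 ^ m(H_0)], as is the
     sum. Hence [a0] divides [w_k v_k], but not [v_k]. *)
  have [g wkE] : divides a0 (w k).
    have [v1 hv1] := alpha_nonzero H0A.
    suff : divides (a0 ^+ m H0) (a0 ^+ (m H0).-1 * (w k * v k)).
      case=> g; rewrite -a0_pred => /(mulfI (expf_neq0 _ a00)) wv.
      by have [|//|//] := lform_prime hb hv1 (p := w k) (q := v k); exists g.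
    have -> : a0 ^+ (m H0).-1 * (w k * v k) =
        d a0 + - \sum_(j | j != k) w j * th' j a0.
      by rewrite wE (bigD1 k) //= addrK th'k vE mulrCA.
    apply: dividesD => //; apply: dividesN; apply: divides_sum => j jk.
    by apply: divides_mull; apply: th'_a0.
  exists (fun i => if i == k then g else w i) => f.
  rewrite wE; apply: eq_bigr => j _; case: eqP => // ->.
  by rewrite wkE /scale_der mulrCA mulrA.
- have wa0 f : \sum_i (if i == k then w k * a0 else w i) * th' i f = 0.
    rewrite -[RHS](w0 f); apply: eq_bigr => j _; case: eqP => // ->.
    by rewrite /scale_der mulrA.
  have := free' _ wa0 i0; case: eqP => [-> /eqP|//].
  by rewrite mulf_eq0 (negbTE a00) orbF => /eqP.
Qed.

End FreePair.

(** * The quotient of the polynomial ring by a linear form *)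

Section Quotient.

Variables (K : fieldType) (V : vectType K) (l : nat) (b : l.-tuple V).
Hypothesis hb : basis_of fullv b.
Variables (f : 'Hom(V, K^o)) (v : V).
Hypothesis fv : f v != 0.
Local Notation S := {mpoly K[l]}.
Local Notation L := (lform b).
Local Notation der := (derivation (mpolyC l (R := K))).
Local Notation derQ := (derivation (fun c : K => pibar b f c%:MP)).

HB.instance Definition _ := GRing.RMorphism.copy (pibar b f)
  (\pi_{ideal_quot (lideal b f)} : S -> {ideal_quot (lideal b f)}).

Lemma pibar_surj (u : Sbar b f) : exists p, pibar b f p = u.
Proof. by exists (repr (u : {ideal_quot (lideal b f)}));
  rewrite /pibar reprK. Qed.

Lemma pibar_eq0 p : pibar b f p = 0 <-> divides (L f) p.
Proof.
rewrite -(rmorph0 (pibar b f)); split=> [/eqP|hp].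
  by rewrite /pibar -Quotient.idealrBE subr0 => /boolp.asboolP.
by apply/eqP; rewrite /pibar -Quotient.idealrBE subr0; apply/boolp.asboolP.
Qed.

Lemma pibar_eq p q : pibar b f p = pibar b f q <-> divides (L f) (p - q).
Proof.
split=> [e|/pibar_eq0]; last by rewrite rmorphB => /eqP; rewrite subr_eq0 =>
  /eqP.
by apply/pibar_eq0; rewrite rmorphB /= e subrr.
Qed.

Lemma pibar_mulI p (u u' : Sbar b f) : ~ divides (L f) p ->
  pibar b f p * u = pibar b f p * u' -> u = u'.
Proof.
have [q <-] := pibar_surj u; have [q' <-] := pibar_surj u'.
move=> np; rewrite -!rmorphM /= => /pibar_eq; rewrite -mulrBr.
by case/(lform_prime hb fv) => // /pibar_eq.
Qed.

(** Preimages of the values on the coordinates serve as coefficients of the lift; agreement then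
    follows from agreement on generators. *)
Lemma der_lift (d : Sbar b f -> Sbar b f) : derQ d ->
  exists2 e, der e & forall p, d (pibar b f p) = pibar b f (e p).
Proof.
move=> [dD dZ dM].
have /fin_all_exists [a aE] (i : 'I_l) : exists p, pibar b f p = d (pibar b f
  'X_i).
  exact: pibar_surj.
have he := der_coord a.
exists (fun p => \sum_i a i * p^`M(i)) => //.
elim/mpoly_alg_ind => [c|i|p q hp hq|p q hp hq].
- rewrite (derC c he) rmorph0 -[pibar b f _]mulr1 dZ.
  suff -> : d 1 = 0 by rewrite mulr0.
  by apply: (addrI (d 1));
    rewrite addr0 -{1}[d 1]mulr1 -{2}[d 1]mul1r -dM mulr1.
- by rewrite coord_X aE.
- by case: he => /= -> _ _; rewrite !rmorphD /= dD hp hq.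
- by case: he => /= _ _ ->; rewrite rmorphM rmorphD !rmorphM /= dM hp hq.
Qed.

End Quotient.

(** * Restriction to [H0] *)

Section Restriction.

Variables (K : fieldType) (V : vectType K) (l : nat) (b : l.-tuple V).
Hypothesis hb : basis_of fullv b.
Local Notation S := {mpoly K[l]}.
Local Notation L := (lform b).
Local Notation der := (derivation (mpolyC l (R := K))).
Implicit Types (H X : {vspace V}).

Variables (A : {fset {vspace V}}) (alpha : {vspace V} -> 'Hom(V, K^o)).
Hypothesis dim_hyp : forall H, H \in A -> (\dim H).+1 = \dim {:V}.
Hypothesis lker_alpha : forall H, H \in A -> lker (alpha H) = H.
Variables (m : {vspace V} -> nat) (H0 : {vspace V}).
Hypotheses (H0A : H0 \in A) (mH0 : (0 < m H0)%N).

Local Notation form := (fun H => L (alpha H)).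
Local Notation a0 := (L (alpha H0)).
Local Notation D := (DS A form m).

(** [alpha_0] and [f] cut out [X] in codimension 2. The vectors [v] and [w] are dual to them, so
    derivatives along [v] and [w] adjust the values on the two forms independently. *)
Lemma dual_pair X (f : 'Hom(V, K^o)) : X \in res_arr A H0 ->
  (H0 :&: lker f)%VS = X -> exists v w,
  [/\ alpha H0 v = 1, f v = 0, alpha H0 w = 0, f w = 1 &
    forall g : 'Hom(V, K^o), (X <= lker g)%VS ->
      g = (g v : K) *: alpha H0 + (g w : K) *: f].
Proof.
move=> /imfsetP [H1 /= /fsetD1P [H1ne H1A] XE] fX.
have [w1 w1H0 fw1] : exists2 w1, w1 \in H0 & f w1 != 0.
  have /subvPn [w1 ? ] : ~~ (H0 <= lker f)%VS.
    apply/negP => /capv_idPl H0f; move: H1ne; rewrite eq_sym => /eqP; apply.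
    by apply: (hyperplane_eq dim_hyp) => //; apply/capv_idPl; rewrite -XE -fX.
  by rewrite memv_ker; exists w1.
have [w fw wE] := lform_dual fw1.
have [v1 hv1] := alpha_nonzero dim_hyp lker_alpha H0A.
have [v2 fv2 _] := lform_dual hv1.
have a0w : alpha H0 w = 0.
  apply/eqP; rewrite -memv_ker lker_alpha // wE.
  exact: memvZ.
(* As [alpha_0] vanishes on [w], this makes [f] vanish without changing the value of [alpha_0]. *)
pose v := v2 - (f v2 : K) *: w.
have a0v : alpha H0 v = 1 by rewrite /v linearB linearZ /= a0w scaler0 subr0.
have fv : f v = 0 by rewrite /v linearB linearZ /= fw [_ *: _]mulr1 subrr.
clearbody v; exists v, w; split=> // g /subvP Xg; apply/lfunP => x.
do !rewrite lfunE /=.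
(* The projection of [x] onto [X] along [v] and [w]. *)
set y := x - (alpha H0 x : K) *: v - (f x : K) *: w.
have yE (h : 'Hom(V, K^o)) : h y = h x - alpha H0 x * (h v : K) - f x * (h w :
  K) :> K.
  by rewrite /y 2!linearB !linearZ.
have : y \in lker g.
  apply: Xg; rewrite -fX memv_cap -{1}(lker_alpha H0A) !memv_ker.
  by rewrite !yE a0v a0w fv fw !mulr1 !mulr0 !subr0 !subrr eqxx.
rewrite memv_ker yE -addrA -opprD subr_eq0 => /eqP ->.
by rewrite mulrC [f x * _]mulrC.
Qed.

Lemma loc_arrP X H : reflect (H \in A /\ (X <= H)%VS) (H \in loc_arr A X).
Proof. by rewrite /loc_arr in_fset; apply: andP. Qed.

Lemma res_arr_le X : X \in res_arr A H0 -> (X <= H0)%VS.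
Proof. by case/imfsetP => H _ ->; exact: capvSl. Qed.

Lemma loc_form_eq X H (f : 'Hom(V, K^o)) v w :
  (forall g : 'Hom(V, K^o), (X <= lker g)%VS ->
      g = (g v : K) *: alpha H0 + (g w : K) *: f) ->
  H \in loc_arr A X ->
  form H = (alpha H v : K) *: a0 + (alpha H w : K) *: L f.
Proof.
by move=> dec /loc_arrP [HA XH];
  rewrite {1}(dec (alpha H)) ?lker_alpha ?lform_comb.
Qed.

(* For [w] in [H0] outside [X], the derivation [prod_(H <> H0) alpha_H ^ m H * d_w]
   of the localization shows that [theta_X] maps the form of X to a unit times a
   power of it, modulo [alpha_0]; the degree of [theta_X] gives the exponent. *)
Lemma euler_local X d (f : 'Hom(V, K^o)) : X \in res_arr A H0 ->
  (H0 :&: lker f)%VS = X -> is_euler_mult b A m alpha H0 X d ->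
  exists th, [/\ DS (loc_arr A X) form m th,
    exists2 c : K, c != 0 & divides a0 (th (L f) - c%:MP * L f ^+ d) &
    forall e, DS (loc_arr A X) form m e ->
      exists c, divides a0 (e (L f) - c * th (L f))].
Proof.
move=> XR fX [e [th [ps [be Xe bth [[_ thX] _] [_ [ps' _ psE]]]]]].
have [v [w [a0v fv a0w fw dec]]] := dual_pair XR fX.
have [Dth span _] := bth.
have hl : (0 < l)%N by rewrite -(size_basis hb) -(dim_hyp H0A).
pose i0 := Ordinal hl.
(* Modulo [alpha_0] only [th] contributes to the value on [f]: [ps] is a multiple of [alpha_0], and
   the other basis members differentiate along vectors of [X], where [f] vanishes. *)
have modth e' : DS (loc_arr A X) form m e' ->
    exists c, divides a0 (e' (L f) - c * th (L f)).
  case/span => c cE; exists (c i0);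
    rewrite cE (bigD1 i0) //= addrAC subrr add0r.
  apply: divides_sum => i ii0; apply: divides_mull; case: eqP => [i00|_].
    by case/eqP: ii0; apply: val_inj.
  case: eqP => [_|/eqP i1]; first by rewrite psE; eexists.
  rewrite partial_lform //; suff -> : f e`_i = 0 by exists 0; rewrite mulr0.
  apply/eqP; rewrite -memv_ker; apply: (subvP (capvSr H0 (lker f))).
  rewrite fX; apply/Xe => j j2; rewrite coord_free ?(basis_free be) //.
  case: eqP => // ji; have : i != i0 by [].
  rewrite -val_eqE /=; move: j2 i1; rewrite -ji.
  by case: (i : nat) => [|[|]].
exists th; split=> //; first by have := Dth i0.
have Dth0 : DS (loc_arr A X) form m th by have := Dth i0.
pose Q := arr_prod b alpha (loc_arr A X `\ H0) m.
have H0X : H0 \in loc_arr A X by apply/loc_arrP; split=> //; exact: res_arr_le.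
have [c cE] : exists c, divides a0 (Q - c * th (L f)).
  have [] := modth (fun p => Q * partial b w p).
    split; first by apply: comb_closed_scale (partial_der b w);
      exact: derivation_comb.
    move=> H HX; rewrite partial_lform //.
    have [->|HH0] := eqVneq H H0; first by exists 0; rewrite a0w !mulr0.
    by apply: divides_mulr; apply: divides_arr_prod; apply/fsetD1P.
  by move=> c; rewrite partial_lform // fw mulr1; exists c.
pose s := lsubst b v (alpha H0).
have sf : s (L f) = L f by rewrite /s lsubst_lform_orth.
have f0 : L f != 0 by apply: (lform_neq0 hb (v := w)); rewrite fw oner_eq0.
(* On [H0], the form of any other hyperplane through [X] is a nonzero multiple of [f]. *)
have [k [N [k0 sQ]]] : exists k N, k != 0 /\ s Q = k%:MP * L f ^+ N.
  rewrite /s /Q /arr_prod rmorph_prod big_seq.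
  apply: (big_ind (fun p => exists k N, k != 0 /\ p = k%:MP * L f ^+ N)).
  - by exists 1, 0%N; rewrite oner_eq0 mpolyC1 expr0 mulr1.
  - move=> _ _ [k [N [k0 ->]]] [k' [N' [k0' ->]]]; exists (k * k'), (N + N')%N.
    by rewrite mulf_neq0 // mpolyCM exprD mulrACA.
  move=> H /fsetD1P [HH0 HX]; have [HA XH] := loc_arrP _ _ HX.
  exists ((alpha H w : K) ^+ m H), (m H); split.
    apply: expf_neq0; apply: contra_neq HH0 => Hw0.
    apply/esym/(hyperplane_eq dim_hyp) => //; apply/subvP => x.
    rewrite -(lker_alpha HA) -{1}(lker_alpha H0A) !memv_ker (dec (alpha H))
      ?lker_alpha //.
    by do !rewrite lfunE /=; rewrite Hw0 scale0r addr0 => /eqP ->;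
      rewrite scaler0.
  rewrite rmorphXn /= (loc_form_eq dec HX) rmorphD /=.
  rewrite -!mul_mpolyC !rmorphM /= -!/s sf /s !lsubstC lsubst_lform0 //.
  by rewrite mulr0 add0r exprMn rmorphXn.
have sc : s c * s (th (L f)) = k%:MP * L f ^+ N.
  have /(lsubst_eq0 hb _ a0v) := cE; rewrite rmorphB rmorphM /= -/s sQ.
  by move/eqP; rewrite subr_eq0 => /eqP.
have fw0 : f w != 0 by rewrite fw oner_eq0.
have factor M (p q : S) : p * q = k%:MP * L f ^+ M ->
    exists j u, [/\ q = u * L f ^+ j & u \is a GRing.unit].
  have kU : (k%:MP : S) \is a GRing.unit by apply: rmorph_unit; rewrite unitfE.
  elim: M p q => [|M ih] p q pq.
    exists 0%N, q; rewrite mulr1; split=> //.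
    by move: kU; rewrite -[k%:MP]mulr1 -[1](expr0 (L f)) -pq unitrM => /andP[].
  have [[p' pE]|[q' qE]] : divides (L f) p \/ divides (L f) q.
    by apply: (lform_prime hb fw0); exists (k%:MP * L f ^+ M);
      rewrite pq exprS mulrCA.
  - apply: (ih p'); apply: (mulfI f0).
    by rewrite mulrA -pE pq exprS mulrCA.
  - have [|j [u [q'E uU]]] := ih p q'.
      by apply: (mulfI f0); rewrite mulrCA -qE pq exprS mulrCA.
    by exists j.+1, u; rewrite qE q'E exprS mulrCA.
have [j [u [sth /unit_const [c' c'0 uE]]]] := factor _ _ _ sc.
have thf : divides a0 (th (L f) - c'%:MP * L f ^+ j).
  by rewrite -uE -sth; exact: lsubst_mod.
exists c' => //; suff <- : j = d by [].
(* If [j] differs from [d], the degree [j] component of [th (L f)] is 0, so [a0] divides a nonzero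
   multiple of [L f ^+ j]; but the substitution fixes [L f]. *)
apply/eqP; apply: contraT => jd.
have thd : th (L f) \is d.-homog.
  rewrite der_lform; last by case: Dth0.
  by apply: rpred_sum => i _; apply: dhomogZ; exact: thX.
have fj : L f ^+ j \is j.-homog.
  by rewrite -[j in j.-homog]mul1n; apply: dhomogMn; exact: lform_homog.
case: thf => g /(congr1 (pihomog mdeg j)).
rewrite raddfB /= (pihomog_ne0 _ thd) 1?eq_sym // sub0r.
rewrite mul_mpolyC linearZ /= pihomog_dE // (pihomogM _ _ (lform_homog b _)) =>
  e1.
have : divides a0 (- (c' *: L f ^+ j)).
  by rewrite e1; case: ifP => _; [eexists|exists 0; rewrite mulr0].
move=> /(lsubst_eq0 hb _ a0v);
  rewrite -mul_mpolyC rmorphN rmorphM rmorphXn /= -/s sf /s lsubstC.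
move=> /eqP; rewrite oppr_eq0 mulf_eq0 expf_eq0 (negbTE f0) andbF orbF.
by rewrite mpolyC_eq0 (negbTE c'0).
Qed.

Lemma DS_loc X d : D d -> DS (loc_arr A X) form m d.
Proof. by case=> hd dA; split=> // H /loc_arrP [HA _]; exact: dA. Qed.

Lemma DS_a0 d : D d -> divides a0 (d a0).
Proof.
case=> _ /(_ _ H0A); rewrite -[X in divides X _]expr1.
exact: divides_exp.
Qed.

Local Notation pb := (pibar b (alpha H0)).
Local Notation Q := (arr_prod b alpha (A `\ H0) m).
Local Notation U X := (arr_prod b alpha (A `\` loc_arr A X) m).

Lemma pibar_a0 p q r : pb (p + a0 * q * r) = pb p.
Proof.
by apply/pibar_eq; exists (q * r); rewrite addrAC subrr add0r mulrA.
Qed.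

(** Subtracting a multiple of [a0] times the derivative along [v] makes [e] kill [a0] and keeps its
    restriction. The factor [Q] takes care of the other hyperplanes. *)
Lemma adjust_a0 e : der e -> divides a0 (e a0) -> exists2 e',
  D (fun p => Q * e' p) & forall p, pb (e' p) = pb (e p).
Proof.
move=> he [g gE]; have [v' hv'] := alpha_nonzero dim_hyp lker_alpha H0A.
have [v hv _] := lform_dual hv'.
exists (fun p => 1 * e p + (- (a0 * g)) * partial b v p) => [|p]; last first.
  by rewrite mul1r -mulrN pibar_a0.
apply: DS_scale => [|H HA].
  apply: comb_closed_lin he (partial_der b v); exact: derivation_comb.
have [->|HH0] := eqVneq H H0.
  by exists 0; rewrite partial_lform // hv mul1r mulr1 gE subrr !mulr0.
by apply/divides_mulr/divides_arr_prod/fsetD1P.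
Qed.

(** Modulo [a0], [e] agrees with a multiple of [theta_X] on [a0] and [f]. Corrections by [a0] times
    the derivatives along [v] and [w] make the agreement exact, hence valid on all forms through
    [X]. The factor [U X] takes care of the others. *)
Lemma adjust_local X d (f : 'Hom(V, K^o)) e : X \in res_arr A H0 ->
  (H0 :&: lker f)%VS = X -> is_euler_mult b A m alpha H0 X d ->
  der e -> divides a0 (e a0) ->
  (exists g, divides a0 (e (L f) - L f ^+ d * g)) -> exists2 e',
  D (fun p => U X * e' p) & forall p, pb (e' p) = pb (e p).
Proof.
move=> XR fX eul he e0 [g gE].
have [th [thX [c c0 thf] _]] := euler_local XR fX eul.
have [v [w [a0v fv a0w fw dec]]] := dual_pair XR fX.
have hth : der th by case: thX.
have H0X : H0 \in loc_arr A X by apply/loc_arrP; split=> //; exact: res_arr_le.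
have th0 : divides a0 (th a0).
  by case: thX => _ /(_ _ H0X); rewrite -[X in divides X _]expr1;
    exact: divides_exp.
pose k := c^-1%:MP * g.
have [g0 g0E] : divides a0 (e a0 - k * th a0).
  by apply: dividesD => //; apply/dividesN/divides_mull.
have [g1 g1E] : divides a0 (e (L f) - k * th (L f)).
  have -> : e (L f) - k * th (L f) =
      (e (L f) - L f ^+ d * g) - k * (th (L f) - c%:MP * L f ^+ d).
    have kE : k * (c%:MP * L f ^+ d) = L f ^+ d * g.
      by rewrite /k mulrCA !mulrA -mpolyCM mulfV // mul1r mulrC.
    by rewrite mulrBr kE opprB addrA subrK.
  by apply: dividesD => //; apply/dividesN/divides_mull.
pose z p := 1 * (1 * e p + (- (a0 * g0)) * partial b v p) + (- (a0 * g1)) *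
  partial b w p.
have hz : der z.
  have C := @derivation_comb K _ (mpolyC l (R := K)).
  apply: (comb_closed_lin _ _ C) (partial_der b w).
  exact: (comb_closed_lin _ _ C he (partial_der b v)).
exists z => [|p]; last by rewrite /z !mul1r -!mulrN !pibar_a0.
have z0 : z a0 = k * th a0.
  rewrite /z !partial_lform // a0v a0w mulr0 addr0 !mul1r mulr1 -g0E.
  by rewrite opprB addrC subrK.
have z1 : z (L f) = k * th (L f).
  rewrite /z !partial_lform // fv fw mulr0 addr0 !mul1r mulr1 -g1E.
  by rewrite opprB addrC subrK.
apply: DS_scale => // H HA; have [HX|HX] := boolP (H \in loc_arr A X).
  apply: divides_mull; rewrite (loc_form_eq dec HX).
  rewrite der_lform_comb // z0 z1 !scalerAr -mulrDr -der_lform_comb //.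
  rewrite -(loc_form_eq dec HX).
  by apply: divides_mull; case: thX => _; apply.
by apply/divides_mulr/divides_arr_prod; rewrite in_fsetD HX.
Qed.

Variables (beta : {vspace V} -> 'Hom(V, K^o)) (mstar : {vspace V} -> nat).
Hypothesis beta_res : forall X, X \in res_arr A H0 ->
  (H0 :&: lker (beta X))%VS = X.
Hypothesis mstar_euler : forall X, X \in res_arr A H0 ->
  is_euler_mult b A m alpha H0 X (mstar X).

Local Notation D'' := (DSbar (res_arr A H0)
  (fun X => pb (L (beta X))) mstar).

(** Locally at [X], the value of [d] on the form of [X] is, modulo [a0], a multiple of that of
    [theta_X], which is a constant times the required power. *)
Lemma derbar_mem d : D d -> D'' (derbar d).
Proof.
move=> Dd; have hd : der d by case: Dd.
have dE p : derbar d (pb p) = pb (d p) by apply: derbarE => //; exact: DS_a0.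
have [dD dZ dM] := hd.
split; first split.
- move=> u u'; have [p <-] := pibar_surj u; have [p' <-] := pibar_surj u'.
  by rewrite -rmorphD /= !dE -rmorphD dD.
- move=> c u; have [p <-] := pibar_surj u.
  by rewrite -rmorphM /= !dE -rmorphM dZ.
- move=> u u'; have [p <-] := pibar_surj u; have [p' <-] := pibar_surj u'.
  by rewrite -rmorphM /= !dE dM rmorphD !rmorphM.
move=> X XR.
have [th [thX [k _ thf] span]] := euler_local XR (beta_res XR) (mstar_euler XR).
have [c cE] := span _ (DS_loc X Dd).
exists (pb (c * k%:MP)); rewrite -rmorphXn -rmorphM /= dE; apply/pibar_eq.
have -> : d (L (beta X)) - L (beta X) ^+ mstar X * (c * k%:MP) =
  (d (L (beta X)) - c * th (L (beta X))) +
     c * (th (L (beta X)) - k%:MP * L (beta X) ^+ mstar X).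
  by rewrite mulrBr addrA subrK [_ * (c * _)]mulrC mulrA.
by apply: dividesD => //; exact: divides_mull.
Qed.

Lemma res_form H : H \in A -> H != H0 -> (H0 :&: H)%VS \in res_arr A H0.
Proof. by move=> HA HH0; apply: in_imfset; apply/fsetD1P. Qed.

(** The substitution turns the claim into one on polynomials, where the restricted form of [H] is
    prime and divides no factor of [U]. *)
Lemma pibar_prime_exp H c e k : H \in A -> H != H0 ->
  pb (U (H0 :&: H)%VS) * c = pb (form H ^+ k) * e ->
  exists c', c = pb (form H ^+ k) * c'.
Proof.
move=> HA HH0; have [v' hv'] := alpha_nonzero dim_hyp lker_alpha H0A.
have [v hv _] := lform_dual hv'; pose s := lsubst b v (alpha H0).
(* The restriction of [alpha H'] to [H0], extended by 0 along [v]. *)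
pose f H' := alpha H' - (alpha H' v : K) *: alpha H0.
have sf H' : s (form H') = L (f H').
  have -> : f H' = 1 *: alpha H' + (- (alpha H' v : K)) *: alpha H0.
    by rewrite scale1r scaleNr.
  by rewrite /s lsubst_lform // lform_comb scale1r scaleNr.
have fx H' x : x \in H0 -> f H' x = alpha H' x.
  rewrite -{1}(lker_alpha H0A) memv_ker => /eqP x0.
  by rewrite /f; do !rewrite lfunE /=; rewrite x0 scaler0 subr0.
have [x xH0 fHx] : exists2 x, x \in H0 & f H x != 0.
  have /subvPn [x xH0 xH] : ~~ (H0 <= H)%VS.
    by apply: contra HH0 => /(hyperplane_eq dim_hyp H0A HA) ->.
  by exists x => //; rewrite fx // -memv_ker lker_alpha.
(* If the restricted form of [H] divided that of [H'], then [H'] would contain the intersection of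
   [H0] and [H], and would not occur in [U]. *)
have nU : ~ divides (L (f H)) (s (U (H0 :&: H)%VS)).
  rewrite /s /arr_prod rmorph_prod.
  apply: (lform_prime_prod hb fHx) => H' /fsetDP [HA' HX] _;
    rewrite rmorphXn /= -/s sf.
  apply: (lform_not_divides_exp hb fHx) => /(divides_lform_lker hb) /subvP ker.
  case/negP: HX; apply/loc_arrP; split=> //; apply/subvP => y; rewrite memv_cap.
  case/andP => yH0; rewrite -{1}(lker_alpha HA) memv_ker -fx // -memv_ker =>
    /ker.
  by rewrite memv_ker fx // -memv_ker lker_alpha.
have smod p : pb (s p) = pb p.
  by apply/esym/pibar_eq; exact: lsubst_mod.
have [p <-] := pibar_surj c; have [q <-] := pibar_surj e.
rewrite -!rmorphM /= => /pibar_eq /(lsubst_eq0 hb _ hv).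
rewrite rmorphB !rmorphM rmorphXn /= -/s sf => /eqP; rewrite subr_eq0 =>
  /eqP e1.
have [|g gE] := lform_exp_prime (k := k) (p := s p) hb fHx nU.
  by exists (s q).
by exists (pb g); rewrite -(smod p) gE rmorphM !rmorphXn /= -sf smod.
Qed.

Section Span.

Variables (I : finType) (d : I -> Sbar b (alpha H0) -> Sbar b (alpha H0)).

Definition spanned (e : Sbar b (alpha H0) -> Sbar b (alpha H0)) : Prop :=
  exists c : I -> Sbar b (alpha H0), forall u, e u = \sum_i c i * d i u.

Hypothesis d_free : forall c : I -> Sbar b (alpha H0),
  (forall u, \sum_i c i * d i u = 0) -> forall i, c i = 0.

Lemma spanned_scale a e : spanned e -> spanned (fun u => a * e u).
Proof.
case=> c cE; exists (fun i => a * c i) => u; rewrite cE mulr_sumr.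
by apply: eq_bigr => i _; rewrite mulrA.
Qed.

(** By independence the two expansions satisfy [U c_i = alpha_H ^ k c'_i]. As [alpha_H] is prime to
    [U] on [H0], its power divides each [c_i] and can be cancelled. *)
Lemma spanned_cancel H k e : H \in A -> H != H0 ->
  spanned (fun u => pb (form H ^+ k) * e u) ->
  spanned (fun u => pb (U (H0 :&: H)%VS) * e u) -> spanned e.
Proof.
move=> HA HH0 [c cE] [c' cE'].
have ndiv : ~ divides a0 (form H ^+ k).
  have [v hv] := alpha_nonzero dim_hyp lker_alpha H0A.
  apply: (lform_not_divides_exp hb hv).
  by apply: (form_not_divides hb dim_hyp) => //; rewrite eq_sym.
have /fin_all_exists [g gE] i : exists g, c i = pb (form H ^+ k) * g.
  apply: (@pibar_prime_exp H (c i) (c' i) k HA HH0).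
  apply/eqP; rewrite -subr_eq0; apply/eqP.
  apply: (d_free (c := fun i =>
    pb (U (H0 :&: H)%VS) * c i - pb (form H ^+ k) * c' i)) => u.
  under eq_bigr do rewrite mulrBl -!mulrA.
  by rewrite sumrB -!mulr_sumr -cE -cE' mulrCA subrr.
have [v hv] := alpha_nonzero dim_hyp lker_alpha H0A.
exists g => u; apply: (pibar_mulI hb hv ndiv); rewrite cE mulr_sumr.
by apply: eq_bigr => i _; rewrite gE mulrA.
Qed.

Lemma spanned_saturated e :
  (forall H, H \in A -> H != H0 -> spanned (fun u =>
    pb (U (H0 :&: H)%VS) * e u)) ->
  spanned (fun u => pb Q * e u) -> spanned e.
Proof.
move=> hU; rewrite /arr_prod.
(* The induction peels factors off the product, keeping every remaining one in [A] and distinct from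
   [H0]. *)
have : {subset (A `\ H0 : seq _) <= A `\ H0} by [].
elim: (A `\ H0 : seq _) => [|H r ih] sub.
  rewrite big_nil rmorph1 => -[c cE]; exists c => u.
  by rewrite -cE mul1r.
have /fsetD1P [HH0 HA] := sub H (mem_head _ _).
rewrite big_cons => hs; apply: ih => [H' H'r|]; first by apply: sub;
  rewrite in_cons H'r orbT.
apply: (@spanned_cancel H (m H)) => //.
  by case: hs => c cE; exists c => u; rewrite -cE rmorphM mulrA.
case: (spanned_scale (pb (\prod_(H <- r) form H ^+ m H)) (hU H HA HH0)) => c cE.
by exists c => u; rewrite -cE mulrCA.
Qed.

Hypothesis d_span : forall e, D e -> spanned (derbar e).

Lemma restriction_spanned e : D'' e -> spanned e.
Proof.
move=> [he eX]; have [e' he' eE] := der_lift he.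
(* The class of [a0] is 0 and [e] kills 0, so any lift preserves the ideal of [a0]. *)
have e'0 : divides a0 (e' a0).
  apply/pibar_eq0; rewrite -eE; have /pibar_eq0 -> : divides a0 a0 by exists 1;
    rewrite mulr1.
  by have [eD _ _] := he; apply: (addrI (e 0)); rewrite -eD !addr0.
have lift a z : D (fun p => a * z p) -> (forall p, pb (z p) = pb (e' p)) ->
    spanned (fun u => pb a * e u).
  move=> Dz zE; have [c cE] := d_span Dz; exists c => u; rewrite -cE.
  have [hz _] := Dz; have [p <-] := pibar_surj u.
  by rewrite (derbarE hz (DS_a0 Dz)) rmorphM /= zE eE.
apply: spanned_saturated => [H HA HH0|].
  have XR := res_form HA HH0.
  have e'X : exists g, divides a0 (e' (L (beta (H0 :&: H)%VS)) -
      L (beta (H0 :&: H)%VS) ^+ mstar (H0 :&: H)%VS * g).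
    have [g] := eX _ XR; have [g' <-] := pibar_surj g.
    by rewrite eE -rmorphXn -rmorphM /= => /pibar_eq; exists g'.
  have [z] := adjust_local XR (beta_res XR) (mstar_euler XR) he' e'0 e'X.
  exact: lift.
have [z] := adjust_a0 he' e'0; exact: lift.
Qed.

End Span.

Variables (th : 'I_l -> S -> S) (k : 'I_l).
Hypothesis th_basis : is_basis (DS A form (del_mult m H0)) th.
Hypothesis adapted :
  is_basis D (fun i => if i == k then scale_der a0 (th k) else th i).

Lemma adapted_mem j : D (th (lift k j)).
Proof. by have [/(_ (lift k j))] := adapted;
  rewrite eq_sym (negbTE (neq_lift k j)). Qed.

Lemma adapted_derbarE j p : derbar (th (lift k j)) (pb p) = pb (th (lift k j)
  p).
Proof.
by apply: derbarE; [case: (adapted_mem j)|exact/DS_a0/adapted_mem].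
Qed.

Lemma restriction_free (c : 'I_l.-1 -> Sbar b (alpha H0)) :
  (forall u, \sum_j c j * derbar (th (lift k j)) u = 0) -> forall j, c j = 0.
Proof.
move=> c0 j; have /fin_all_exists [C CE] (i : 'I_l.-1) : exists p, pb p = c i.
  exact: pibar_surj.
pose w p := \sum_i C i * th (lift k i) p.
have Dw : D w by apply: (Dmod_comb (I := 'I_l.-1)) => i; exact: adapted_mem.
have hw : der w by case: Dw.
have /fin_all_exists [g gE] (i : 'I_l) : divides a0 (w 'X_i).
  apply/pibar_eq0; rewrite /w rmorph_sum -[RHS](c0 (pb 'X_i)).
  by apply: eq_bigr => t _; rewrite adapted_derbarE rmorphM /= CE.
pose h p := \sum_i g i * p^`M(i).
have hh : der h by exact: der_coord.
have wE p : w p = a0 * h p.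
  rewrite (derE p hw) /h mulr_sumr.
  by apply: eq_bigr => i _; rewrite gE mulrA.
have [v hv] := alpha_nonzero dim_hyp lker_alpha H0A.
have a00 : a0 != 0 by exact: (lform_neq0 hb hv).
(* At [H0] one factor [a0] cancels, which leaves the exponent of the deletion. Elsewhere [alpha_H]
   is prime and does not divide [a0]. *)
have Dh : DS A form (del_mult m H0) h.
  split=> // H HA; have [_ /(_ H HA)] := Dw; rewrite /del_mult.
  have [->|HH0] := eqVneq H H0 => -[q qE].
    exists q; apply: (mulfI a00).
    by rewrite -wE qE mulrA -exprS prednK.
  have [v' hv'] := alpha_nonzero dim_hyp lker_alpha HA.
  apply: (lform_exp_prime (u := a0) hb hv'); last by exists q; rewrite -wE.
  exact: (form_not_divides hb dim_hyp).
have [_ span _] := th_basis; have [d dE] := span _ Dh.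
(* Padding with 0 at [k] allows comparison with the expansion of [a0 h] in the full basis of
   [D']. *)
pose C' i := if unlift k i is Some t then C t else 0.
have e f : \sum_i C' i * th i f = \sum_i (a0 * d i) * th i f.
  rewrite (bigD1_ord k) //= {1}/C' unlift_none mul0r add0r.
  transitivity (w f); first by apply: eq_bigr => t _; rewrite /C' liftK.
  by rewrite wE dE mulr_sumr; apply: eq_bigr => t _; rewrite mulrA.
have := is_basis_inj th_basis e (lift k j); rewrite /C' liftK => Cj.
by rewrite -CE Cj; apply/pibar_eq0; eexists.
Qed.

Lemma derbar_spanned e : D e ->
  spanned (fun j : 'I_l.-1 => derbar (th (lift k j))) (derbar e).
Proof.
move=> De; have [_ span _] := adapted; have [c cE] := span _ De.
have [he _] := De.
exists (fun j => pb (c (lift k j))) => u; have [p <-] := pibar_surj u.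
rewrite (derbarE he (DS_a0 De)) cE (bigD1_ord k) //= eqxx /scale_der rmorphD
  rmorph_sum /=.
have -> : pb (c k * (a0 * th k p)) = 0.
  by apply/pibar_eq0; exists (c k * th k p); rewrite mulrCA.
rewrite add0r; apply: eq_bigr => j _.
by rewrite eq_sym (negbTE (neq_lift k j)) adapted_derbarE rmorphM.
Qed.

Lemma restriction_basis : is_basis D'' (fun j : 'I_l.-1 =>
  derbar (th (lift k j))).
Proof.
split=> [j|e|]; first exact/derbar_mem/adapted_mem.
  by move=> De; apply: restriction_spanned De;
    [exact: restriction_free|exact: derbar_spanned].
exact: restriction_free.
Qed.

End Restriction.

Theorem theorem0p6 (K : fieldType) (V : vectType K) (l : nat) (hl : (2 <= l)%N)
  (b : l.-tuple V) (hb : basis_of fullv b)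
  (A : {fset {vspace V}}) (m : {vspace V} -> nat)
  (hA : multiarrangement A m)
  (alpha : {vspace V} -> 'Hom(V, K^o))
  (halpha : forall H, H \in A -> lker (alpha H) = H)
  (H0 : {vspace V}) (hH0 : H0 \in A)
  (* Euler multiplicity on A'' *)
  (mstar : {vspace V} -> nat)
  (hmstar : forall X, X \in res_arr A H0 ->
     is_euler_mult b A m alpha H0 X (mstar X))
  (* defining forms in H0 of the hyperplanes of A'', as restrictions to H0 of
     linear forms on V *)
  (beta : {vspace V} -> 'Hom(V, K^o))
  (hbeta : forall X, X \in res_arr A H0 -> (H0 :&: lker (beta X))%VS = X) :
  let form H := lform b (alpha H) in
  let a0 := form H0 in
  let D := DS A form m in
  let D' := DS (del_arr A m H0) form (del_mult m H0) in
  let D'' := DSbar (res_arr A H0) (fun X => pibar b (alpha H0) (lform b (beta X)))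
               mstar in
  let adapted (th : 'I_l -> {mpoly K[l]} -> {mpoly K[l]}) (k : 'I_l) :=
    is_basis D' th /\
    is_basis D (fun i => if i == k then scale_der a0 (th k) else th i) in
  free_module D -> free_module D' ->
  (exists th k, adapted th k) /\
  (forall th k, adapted th k ->
     is_basis D'' (fun j : 'I_l.-1 => derbar (th (lift k j)))).
Proof.
move=> form a0 D D' D'' adapted freeD freeD'.
have dim_hyp H : H \in A -> (\dim H).+1 = \dim {:V} by move/hA => [].
have mH0 : (0 < m H0)%N by have [] := hA H0 hH0.
have delE d : D' d <-> DS A form (del_mult m H0) d by exact: DS_del_arr.
have adaptedE th k : adapted th k <-> is_basis (DS A form (del_mult m H0)) th /\
    is_basis D (fun i => if i == k then scale_der a0 (th k) else th i).
  by split=> -[h1 h2]; split=> //; apply: is_basis_iff h1 => d; split; move/delE.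
split=> [|th k /adaptedE [bth bD]].
  have [|th [k /adaptedE ?]] := exists_adapted hb dim_hyp halpha hH0 mH0 freeD.
    by have [n [th bth]] := freeD'; exists n, th; apply: is_basis_iff bth.
  by exists th, k.
exact: (restriction_basis hb dim_hyp halpha hH0 mH0 hbeta hmstar bth bD).
Qed.
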